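(* Let $n\ge 3$ be an integer and let $K(C_4\times C_n)$ be the critical group of the Cartesian product graph $C_4\times C_n$. Write $Z_k=\mathbb{Z}/k\mathbb{Z}$ and let $(a_1,\dots,a_r)$ denote the greatest common divisor. If $n=2s+1$ is odd, then $$K(C_4\times C_n)\cong Z_{(n,\, h_s,\, g_s)}\oplus Z_{(h_s,\, g_s)}\oplus Z_{\frac{(n,\, h_s)(h_s,\, g_s)}{(n,\, h_s,\, g_s)}}\oplus Z_{h_s}\oplus Z_{\frac{h_s(nh_s,\, ng_s,\, h_sg_s)}{(n,\, h_s)(h_s,\, g_s)}}\oplus Z_{\frac{h_sg_s}{(h_s,\, g_s)}}\oplus Z_{\frac{4nh_sg_s}{(nh_s,\, ng_s,\, h_sg_s)}}.$$ If $n=2s$ with $s$ odd, then $$K(C_4\times C_n)\cong Z_{(s,\, e_s,\, f_s)}\oplus Z_{(e_s,\, f_s)}\oplus Z_{\frac{(s,\, e_s)(e_s,\, f_s)}{(s,\, e_s,\, f_s)}}\oplus Z_{e_s}\oplus Z_{\frac{4e_s(se_s,\, sf_s,\, e_sf_s)}{(s,\, e_s)(e_s,\, f_s)}}\oplus Z_{\frac{12e_sf_s}{(e_s,\, f_s)}}\oplus Z_{\frac{48se_sf_s}{(se_s,\, sf_s,\, e_sf_s)}}.$$ If $n=2s$ with $s$ even, then $$K(C_4\times C_n)\cong Z_{(s,\, e_s,\, f_s)}\oplus Z_{(e_s,\, f_s)}\oplus Z_{\frac{4(s,\, e_s)(e_s,\, f_s)}{(s,\, e_s,\, f_s)}}\oplus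 Z_{6e_s}\oplus Z_{\frac{6e_s(se_s,\, sf_s,\, e_sf_s)}{(s,\, e_s)(e_s,\, f_s)}}\oplus Z_{\frac{2e_sf_s}{(e_s,\, f_s)}}\oplus Z_{\frac{8se_sf_s}{(se_s,\, sf_s,\, e_sf_s)}}.$$
   Context: For a finite connected graph $G=(V,E)$ (no loops, multiple edges allowed), the Laplacian $L(G)$ is the $|V|\times|V|$ integer matrix with $L_{uu}=\deg(u)$ and $L_{uv}=-a_{uv}$ for $u\ne v$, where $a_{uv}$ is the number of edges joining $u,v$. If the Smith normal form of $L(G)$ is $\mathrm{diag}(t_1,\dots,t_{|V|-1},0)$, the critical group is $K(G)=\bigoplus_{i=1}^{|V|-1}\mathbb{Z}/t_i\mathbb{Z}$ (equivalently, the torsion subgroup of $\mathbb{Z}^{|V|}/\mathrm{im}\,L(G)$). $C_n$ is the cycle on $n$ vertices; $C_4\times C_n$ is the Cartesian product: vertex set $V(C_4)\times V(C_n)$, with $(u_1,v_1)\sim(u_2,v_2)$ iff ($u_1=u_2$ and $v_1v_2$ is an edge) or ($u_1u_2$ is an edge and $v_1=v_2$). For a positive integer $m$ let $\alpha(m)=\frac{m+2+\sqrt{m^2+4m}}{2}$, $\beta(m)=\frac{m+2-\sqrt{m^2+4m}}{2}$, and $u_p(m)=\frac{\alpha(m)^p-\beta(m)^p}{\alpha(m)-\beta(m)}$. Set $e_k=u_k(2)$, $f_k=u_k(4)$ (so $e_0=0,e_1=1,e_{k+1}=4e_k-e_{k-1}$ and $f_0=0,f_1=1,f_{k+1}=6f_k-f_{k-1}$),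 $h_k=e_k+e_{k+1}$, $g_k=f_k+f_{k+1}$. *)

(* Defs.v *)
From HB Require Import structures.
From mathcomp Require Import all_boot all_order all_algebra all_field.
From mathcomp Require Import generic_quotient ring_quotient boolp ring zify.

Set Implicit Arguments.
Unset Strict Implicit.
Unset Printing Implicit Defensive.

Import Order.TTheory GRing.Theory Num.Theory.

Local Open Scope ring_scope.
Local Open Scope quotient_scope.

(* Finite loopless multigraphs, given by their edge multiplicities. *)
Record mgraph := MGraph {
  vert :> finType;
  mult : vert -> vert -> nat;
  mult_sym : forall u v, mult u v = mult v u;
  mult_loopless : forall u, mult u u = 0%N
}.

(* The factor i != j only matters for n = 1, where it removes the loops; for
   n = 2 one gets two vertices joined by a double edge. *)
Definition cycle_mult (n : nat) (i j : 'I_n) : nat :=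
  ((i != j) * ((ordS i == j) + (ordS j == i)))%N.

Fact cycle_mult_sym n (i j : 'I_n) : cycle_mult i j = cycle_mult j i.
Proof. by rewrite /cycle_mult eq_sym addnC. Qed.

Fact cycle_mult_loopless n (i : 'I_n) : cycle_mult i i = 0%N.
Proof. by rewrite /cycle_mult eqxx. Qed.

Definition cycle_graph (n : nat) : mgraph :=
  MGraph (@cycle_mult_sym n) (@cycle_mult_loopless n).

Definition cart_mult (G H : mgraph) (x y : G * H) : nat :=
  ((x.1 == y.1) * mult x.2 y.2 + (x.2 == y.2) * mult x.1 y.1)%N.

Fact cart_mult_sym (G H : mgraph) (x y : G * H) : cart_mult x y = cart_mult y x.
Proof.
by rewrite /cart_mult (eq_sym x.1) (eq_sym x.2) (mult_sym x.2) (mult_sym x.1).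
Qed.

Fact cart_mult_loopless (G H : mgraph) (x : G * H) : cart_mult x x = 0%N.
Proof. by rewrite /cart_mult !mult_loopless !muln0. Qed.

Definition cart_prod (G H : mgraph) : mgraph :=
  MGraph (@cart_mult_sym G H) (@cart_mult_loopless G H).

Definition degree (G : mgraph) (u : G) : nat := (\sum_(v : G) mult u v)%N.

Definition laplacian (G : mgraph) : 'M[int]_#|G| :=
  \matrix_(i, j)
    if i == j then (degree (enum_val i))%:Z
    else - (mult (enum_val i) (enum_val j))%:Z.

Definition im_laplacian (G : mgraph) : {pred 'cV[int]_#|G|} :=
  [pred x | `[< exists y : 'cV[int]_#|G|, x = laplacian G *m y >]].

Fact im_laplacian_zmod_closed (G : mgraph) : zmod_closed (@im_laplacian G).
Proof.
split=> [|_ _ /asboolP[x ->] /asboolP[y ->]]; apply/asboolP.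
  by exists 0; rewrite mulmx0.
by exists (x - y); rewrite mulmxBr.
Qed.

HB.instance Definition _ (G : mgraph) :=
  GRing.isZmodClosed.Build 'cV[int]_#|G| (@im_laplacian G)
    (im_laplacian_zmod_closed G).

Definition coker_laplacian (G : mgraph) : zmodType :=
  Quotient.quot (@im_laplacian G).

Section Torsion.
Variable A : zmodType.

Definition torsion : {pred A} :=
  [pred x | `[< exists2 k : nat, (0 < k)%N & x *+ k = 0 >]].

Fact torsion_zmod_closed : zmod_closed torsion.
Proof.
split=> [|x y /asboolP[k k0 xk] /asboolP[l l0 yl]]; apply/asboolP.
  by exists 1%N.
exists (k * l)%N; first by rewrite muln_gt0 k0.
by rewrite mulrnBl mulrnA xk mul0rn sub0r mulnC mulrnA yl mul0rn oppr0.
Qed.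

HB.instance Definition _ :=
  GRing.isZmodClosed.Build A torsion torsion_zmod_closed.

Record torsion_of := Torsion { torsion_val :> A; _ : torsion_val \in torsion }.

HB.instance Definition _ := [isSub for torsion_val].
HB.instance Definition _ := [Choice of torsion_of by <:].
HB.instance Definition _ := [SubChoice_isSubZmodule of torsion_of by <:].

End Torsion.

(* For a connected graph the cokernel of the Laplacian has rank 1, and its
   torsion subgroup is the direct sum of the Z/t_i over the nonzero invariant
   factors t_i of the Laplacian. *)
Definition critical_group (G : mgraph) : zmodType :=
  torsion_of (coker_laplacian G).

Definition Zmod (k : nat) : zmodType := Quotient.quot (dvdz k%:Z : {pred int}).

Definition dsum (A B : zmodType) : zmodType := (A * B)%type.

Notation "A \oplus B" := (dsum A B) (at level 50, left associativity).

Definition zmod_iso (A B : zmodType) : Prop :=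
  exists f : {additive A -> B}, bijective f.

Notation "A \simeq B" := (zmod_iso A B) (at level 70, no associativity).

Definition gcd3 (a b c : nat) : nat := gcdn (gcdn a b) c.

Definition alpha (m : nat) : algC :=
  ((m + 2)%:R + sqrtC (m ^ 2 + 4 * m)%:R) / 2%:R.

Definition beta (m : nat) : algC :=
  ((m + 2)%:R - sqrtC (m ^ 2 + 4 * m)%:R) / 2%:R.

Definition useq (m p : nat) : algC :=
  (alpha m ^+ p - beta m ^+ p) / (alpha m - beta m).

(* For m > 0 the number useq m p is a natural number, and uN m p is that number as
   an element of nat (uN_natr). *)
Definition uN (m p : nat) : nat := Num.truncn (useq m p).

Definition e_ (k : nat) : nat := uN 2 k.
Definition f_ (k : nat) : nat := uN 4 k.
Definition h_ (k : nat) : nat := (e_ k + e_ k.+1)%N.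
Definition g_ (k : nat) : nat := (f_ k + f_ k.+1)%N.

Section ClosedForm.
Variables (m : nat) (m_gt0 : (0 < m)%N).

Let sum_ab : alpha m + beta m = (m + 2)%:R.
Proof. by rewrite /alpha /beta; field. Qed.

Let prod_ab : alpha m * beta m = 1.
Proof.
rewrite /alpha /beta; set s := sqrtC _.
have s2 : s ^+ 2 = (m ^ 2 + 4 * m)%:R by rewrite sqrtCK.
rewrite natrD natrX natrM in s2; rewrite natrD.
transitivity (((m%:R + 2%:R) ^+ 2 - s ^+ 2) / 4%:R : algC); first by field.
by rewrite s2; field.
Qed.

Let ab_neq0 : alpha m - beta m != 0.
Proof.
have -> : alpha m - beta m = sqrtC (m ^ 2 + 4 * m)%:R.
  by rewrite /alpha /beta; field.
by rewrite sqrtC_eq0 pnatr_eq0 -lt0n addn_gt0 expn_gt0 m_gt0.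
Qed.

Lemma useq0 : useq m 0 = 0.
Proof. by rewrite /useq !expr0 subrr mul0r. Qed.

Lemma useq1 : useq m 1 = 1.
Proof. by rewrite /useq !expr1 divff. Qed.

Lemma useq_rec p : useq m p.+2 = (m + 2)%:R * useq m p.+1 - useq m p.
Proof.
rewrite /useq mulrA -[RHS]mulrBl; congr (_ / _); rewrite -sum_ab.
rewrite -[X in _ = _ - X]mul1r -[in RHS]prod_ab !exprS.
by ring.
Qed.

Lemma useq_nat p :
  exists2 k : nat * nat, (k.1 <= k.2)%N &
    useq m p = k.1%:R /\ useq m p.+1 = k.2%:R.
Proof.
elim: p => [|p [[a b] /= ab [ea eb]]].
  by exists (0, 1)%N => //; rewrite useq0 useq1.
exists (b, (m + 2) * b - a)%N => /=; first by nia.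
split=> //; rewrite useq_rec ea eb natrB ?natrM //; nia.
Qed.

Lemma uN_natr p : (uN m p)%:R = useq m p.
Proof. by have [[a b] _ [/= ea _]] := useq_nat p; rewrite /uN ea natrK. Qed.

Lemma uN0 : uN m 0 = 0%N.
Proof. by apply/eqP; rewrite -(eqr_nat algC) uN_natr useq0. Qed.

Lemma uN1 : uN m 1 = 1%N.
Proof. by apply/eqP; rewrite -(eqr_nat algC) uN_natr useq1. Qed.

Lemma uN_rec p : (uN m p.+2 + uN m p = (m + 2) * uN m p.+1)%N.
Proof.
by apply/eqP; rewrite -(eqr_nat algC) natrD natrM !uN_natr useq_rec subrK.
Qed.

End ClosedForm.

(* Main.v *)
Require Import Defs.
From HB Require Import structures.
From mathcomp Require Import all_boot all_order all_algebra.
From mathcomp Require Import generic_quotient ring_quotient perm boolp ring zify.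

(* Let R = Z[t]/(t^4 - 1) and a = 4 - t - t^-1. The cokernel of the Laplacian of
   C_4 x C_n is R[x]/(x^n - 1, a - x - x^-1). Eliminating powers of x with
   x^2 = a x - 1 identifies it with the cokernel of M^n - 1 acting on R^2, where M
   is the companion matrix of x^2 - a x + 1. With u_0 = 0, u_1 = 1,
   u_(k+2) = a u_(k+1) - u_k one has M^s - M^-s = u_s (M - M^-1) and
   M^(s+1) - M^-s = (u_s + u_(s+1)) (M - 1), so up to a unit M^n - 1 is a scalar
   of R times a fixed matrix. Two square integer matrices have isomorphic
   cokernels as soon as they are equivalent over Z_(p) for every prime p. For odd
   p, evaluation at the fourth roots of unity splits R (there a takes the values
   2, 4, 4, 6, so that u_s becomes s, e_s, e_s, f_s) and diagonalises everything.
   For p = 2 the scalar is a unit, or a power of 2 times a times a unit, which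
   leaves three constant matrices. It remains to compare p-adic valuations; only
   p = 2 and p = 3 need arithmetic properties of e_s and f_s. *)

Set Implicit Arguments.
Unset Strict Implicit.
Unset Printing Implicit Defensive.

Import Order.TTheory GRing.Theory Num.Theory.

Local Open Scope ring_scope.
Local Open Scope quotient_scope.

(** * Presentations and torsion subgroups *)

(** The change of basis to the characters of C_4 has determinant plus or minus a power of 2, so the
    splitting into eigenvalues is lost exactly at p = 2; there the constant matrices come with
    explicit Smith normal forms instead. At odd p, elimination leaves the blocks u and u (a - 2) for
    odd n, and u and u (a^2 - 4) for n = 2s, with u the scalar of R. At the eigenvalues, a - 2 takes
    the values 0, 4, 2, 2 and a^2 - 4 the values 0, 32, 12, 12. The 0 yields the free summand Z, and
    the 3 in 12 is the only odd prime among these constants. For odd s, 3 does not divide f_s; for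
    even s, f_s has more factors 3 than e_s. Hence the constant 3 sits in different summands in the
    two cases. The summands are never arranged into a divisibility chain: at p a diagonal matrix
    matters only through the multiset of valuations of its entries, so what remains is a
    rearrangement of exponents. *)

Lemma zmod_isoI (A B : zmodType) (f : A -> B) :
  zmod_morphism f -> bijective f -> A \simeq B.
Proof.
move=> fB f_bij.
pose f' : {additive A -> B} := HB.pack f (GRing.isZmodMorphism.Build A B f fB).
by exists f'.
Qed.

Lemma zmod_iso_sym (A B : zmodType) : A \simeq B -> B \simeq A.
Proof.
case=> f [g fK gK]; apply: (@zmod_isoI _ _ g); last by exists f.
exact: can2_zmod_morphism fK gK.
Qed.

Lemma zmod_iso_trans (A B C : zmodType) : A \simeq B -> B \simeq C -> A \simeq C.
Proof.
case=> f fbij [g gbij]; apply: (@zmod_isoI _ _ (g \o f)); last exact: bij_comp.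
by move=> x y /=; rewrite !raddfB.
Qed.

(** Keeping the kernel as a predicate lets cokernels of different matrices be compared without
    forming quotient types. *)
Definition presentation (V X : zmodType) (K : V -> Prop) (f : V -> X) : Prop :=
  [/\ zmod_morphism f, forall x, exists v, f v = x & forall v, f v = 0 <-> K v].

(** Maps with the same kernel identify the same pairs, so [g] composed with any section of [f] is
    additive, with inverse [f] composed with a section of [g]. *)
Lemma presentation_iso (V X Y : zmodType) (K : V -> Prop) (f : V -> X) (g : V -> Y) :
  presentation K f -> presentation K g -> X \simeq Y.
Proof.
move=> [fB f_surj fK] [gB g_surj gK].
have [s sK] := choice f_surj.
have [t tK] := choice g_surj.
have eq_fg v w : f v = f w <-> g v = g w.
  split=> e; apply/eqP; rewrite -subr_eq0; apply/eqP.
    by rewrite -gB; apply/gK/fK; rewrite fB e subrr.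
  by rewrite -fB; apply/fK/gK; rewrite gB e subrr.
apply: (@zmod_isoI _ _ (g \o s)) => [x y /=|].
  by rewrite -gB; apply/eq_fg; rewrite fB !sK.
exists (f \o t) => x /=.
  by rewrite -[RHS]sK; apply/eq_fg; rewrite tK.
by rewrite -[RHS]tK; apply/eq_fg; rewrite sK.
Qed.

Lemma torsionP (A : zmodType) (x : A) :
  reflect (exists2 k, (0 < k)%N & x *+ k = 0) (x \in @torsion A).
Proof. exact: asboolP. Qed.

Lemma torsion_iso (A B : zmodType) :
  A \simeq B -> torsion_of A \simeq torsion_of B.
Proof.
case=> f [g fK gK].
have gB : zmod_morphism g by exact: can2_zmod_morphism fK gK.
pose g' : {additive B -> A} := HB.pack g (GRing.isZmodMorphism.Build B A g gB).
have tor_f (x : torsion_of A) : f (val x) \in @torsion B.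
  have /torsionP[k k0 xk] := valP x; apply/torsionP; exists k => //.
  by rewrite -raddfMn xk raddf0.
have tor_g (x : torsion_of B) : g' (val x) \in @torsion A.
  have /torsionP[k k0 xk] := valP x; apply/torsionP; exists k => //.
  by rewrite -raddfMn xk raddf0.
apply: (@zmod_isoI _ _ (fun x => Sub (f (val x)) (tor_f x))).
  by move=> x y; apply: val_inj; rewrite [RHS]raddfB !SubK raddfB -raddfB.
by exists (fun x => Sub (g' (val x)) (tor_g x)) => x; apply: val_inj;
  rewrite !SubK /= ?fK ?gK.
Qed.

Lemma torsion_prod_int (T : zmodType) :
  (exists2 k, (0 < k)%N & forall x : T, x *+ k = 0) ->
  torsion_of (T * int)%type \simeq T.
Proof.
case=> k k0 Tk; apply: zmod_iso_sym.
have tor (x : T) : (x, 0 : int) \in @torsion (T * int)%type.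
  apply/torsionP; exists k => //.
  by apply/eqP; rewrite -pair_eqE /= !raddfMn /= Tk mul0rn !eqxx.
apply: (@zmod_isoI _ _ (fun x => Sub (x, 0 : int) (tor x))).
  by move=> x y; apply: val_inj; rewrite [RHS]raddfB !SubK; congr pair; rewrite subrr.
exists (fun x => (val x).1) => [x|x]; first by rewrite SubK.
apply: val_inj; rewrite SubK.
have /torsionP[l l0 xl] := valP x.
case E: (val x) xl => [y z] /= xl.
have : z *+ l = 0.
  by have := congr1 snd xl; rewrite raddfMn.
by move/eqP; rewrite mulrn_eq0 eqn0Ngt l0 /= => /eqP ->.
Qed.

(** * The cokernel of the Laplacian of a torus grid *)

(** In difference form the term at the vertex itself vanishes, which absorbs the degree on the
    diagonal. *)
Lemma laplacian_mulE (G : mgraph) (f : G -> int) :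
  laplacian G *m (\col_i f (enum_val i)) =
  \col_i \sum_(u : G) (mult (enum_val i) u)%:Z * (f (enum_val i) - f u).
Proof.
apply/colP => i; rewrite !mxE.
transitivity (\sum_(u : G) (if enum_val i == u then (degree (enum_val i))%:Z
    else - (mult (enum_val i) u)%:Z) * f u).
  rewrite [RHS](reindex _ (onW_bij _ (@enum_val_bij G))).
  by apply: eq_bigr => j _; rewrite !mxE (inj_eq enum_val_inj).
rewrite (bigD1 (enum_val i)) //= eqxx [RHS](eq_bigr _ (fun u _ => mulrBr _ _ _)).
rewrite sumrB -mulr_suml -(big_morph Posz PoszD (erefl _)) -/(degree _).
congr (_ + _); rewrite [X in _ = - X](bigD1 (enum_val i)) //= mult_loopless mul0r.
rewrite add0r -sumrN; apply: eq_bigr => u.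
by rewrite eq_sym => /negPf ->; rewrite mulNr.
Qed.

(** For n = 2 the two neighbours coincide and the double edge counts them twice, in agreement with
    the right-hand side. *)
Lemma cycle_mult_sum n (i : 'I_n) (F : 'I_n -> int) : (1 < n)%N ->
  \sum_j (cycle_mult i j)%:Z * F j = F (ordS i) + F (ord_pred i).
Proof.
move=> n_gt1.
have SneqI (k : 'I_n) : (ordS k == k) = false.
  apply/negP => /eqP/(congr1 val)/=; have := ltn_ord k.
  rewrite leq_eqVlt => /orP[/eqP kn|lt_kn]; first by rewrite kn modnn; lia.
  by rewrite modn_small //; lia.
transitivity (\sum_j ((ordS i == j)%:Z * F j + (ord_pred i == j)%:Z * F j)).
  apply: eq_bigr => j _; rewrite -mulrDl -PoszD; congr (_%:Z * _).
  have -> : (ord_pred i == j) = (ordS j == i).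
    by rewrite (can2_eq (@ord_predK n) (@ordSK n)) eq_sym.
  rewrite /cycle_mult; have [->|_] := eqVneq i j; last by rewrite mul1n.
  by rewrite SneqI.
rewrite big_split /=; congr (_ + _).
  rewrite (bigD1 (ordS i)) //= eqxx mul1r big1 ?addr0 // => j.
  by rewrite eq_sym => /negPf ->; rewrite mul0r.
rewrite (bigD1 (ord_pred i)) //= eqxx mul1r big1 ?addr0 // => j.
by rewrite eq_sym => /negPf ->; rewrite mul0r.
Qed.

(* The matrix of multiplication by [4 - t - t^-1] on [Z[t]/(t^4 - 1)]. *)
Definition stepC4 : 'M[int]_4 :=
  \matrix_(i, j) (if i == j then 4 else - (odd (i + j))%:Z).

Lemma stepC4E (v : 'cV[int]_4) i :
  (stepC4 *m v) i 0 = 4 * v i 0 - v (ordS i) 0 - v (ord_pred i) 0.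
Proof.
rewrite mxE !big_ord_recl big_ord0 !mxE.
(* Indexing by naturals identifies ordinals that differ only in their bound proofs, so that [ring]
   sees equal atoms. *)
pose v_ k := v (inord k) 0.
have vE (x : 'I_4) : v x 0 = v_ x by rewrite /v_ inord_val.
by case: i => [[|[|[|[|i]]]] lti] //; rewrite !vE /= /bump /=; ring.
Qed.

Section Companion.
Variable m : nat.
Implicit Types a b : 'M[int]_m.

Definition diag2 a : 'M[int]_(m + m) := block_mx a 0 0 a.

(* Multiplication by [x] and [x^-1] on [R[x]/(x^2 - a x + 1)] in the basis [1, x]. *)
Definition companion a : 'M[int]_(m + m) := block_mx 0 (- 1%:M) 1%:M a.

Definition companionV a : 'M[int]_(m + m) := block_mx a 1%:M (- 1%:M) 0.

Lemma block1 : 1 = block_mx 1%:M 0 0 1%:M :> 'M[int]_(m + m).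
Proof. exact: scalar_mx_block. Qed.

Lemma companionD a : companion a + companionV a = diag2 a.
Proof. by rewrite add_block_mx add0r addr0 addNr addrN. Qed.

Lemma companionK a : companionV a * companion a = 1.
Proof.
rewrite -mulmxE mulmx_block !mulmx0 !mul0mx mulmx1 mul1mx mulmxN mulmx1 add0r.
by rewrite addNr addr0 mulNmx mul1mx opprK addr0 block1.
Qed.

Lemma companionVK a : companion a * companionV a = 1.
Proof. by apply/mulmx1C/companionK. Qed.

Lemma diag2D a b : diag2 (a + b) = diag2 a + diag2 b.
Proof. by rewrite add_block_mx !addr0. Qed.

Lemma diag2B a b : diag2 (a - b) = diag2 a - diag2 b.
Proof. by rewrite opp_block_mx add_block_mx !oppr0 !addr0. Qed.

Lemma diag2M a b : diag2 (a *m b) = diag2 a * diag2 b.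
Proof. by rewrite -mulmxE mulmx_block !mulmx0 !mul0mx !addr0 !add0r. Qed.

(** With C the companion matrix, a = C + C^-1 turns the sum into two telescoping ones; only the
    wrap-around between the last and the first layer survives, and it carries the factor C^(n+1) -
    1. *)
Lemma companion_cyclic_sum a (n : nat) (y : 'I_n.+1 -> 'cV[int]_m) :
  \sum_(j < n.+1) companion a ^+ j *m
    col_mx (a *m y j - y (ordS j) - y (ord_pred j)) 0 =
  (companion a ^+ n.+1 - 1) *m
    (col_mx (y ord_max) 0 - companionV a *m col_mx (y ord0) 0).
Proof.
set C := companion a; set C' := companionV a.
have CC' : C *m C' = 1%:M by exact: companionVK.
pose i v : 'cV[int]_(m + m) := col_mx v 0.
have iB v w : i (v - w) = i v - i w.
  by rewrite /i opp_col_mx add_col_mx oppr0 addr0.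
have iM v : i (a *m v) = C *m i v + C' *m i v.
  by rewrite -mulmxDl companionD mul_block_col !mulmx0 !mul0mx !addr0.
rewrite -!/(i _); under eq_bigr do rewrite -/(i _) !iB iM !mulmxBr mulmxDr.
rewrite !sumrB big_split /=.
have -> : \sum_(j < n.+1) C ^+ j *m (C *m i (y j)) =
   \sum_(j < n.+1) C ^+ j *m i (y (ord_pred j)) + (C ^+ n.+1 - 1) *m i (y ord_max).
  rewrite big_ord_recr [X in _ = X + _]big_ord_recl /= expr0 mul1mx.
  rewrite mulmxBl mul1mx exprSr -mulmxE mulmxA.
  have -> : ord_pred ord0 = ord_max :> 'I_n.+1.
    by apply: val_inj; rewrite /= modn_small.
  rewrite addrAC addrCA subrr addr0 [RHS]addrC; congr (_ + _).
  apply: eq_bigr => j _; rewrite mulmxA /bump /= add1n exprSr -mulmxE.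
  congr (_ *m i (y _)); apply: val_inj => /=.
  by rewrite add0n modnDr modn_small // ltnS ltnW.
have -> : \sum_(j < n.+1) C ^+ j *m (C' *m i (y j)) =
   \sum_(j < n.+1) C ^+ j *m i (y (ordS j)) - (C ^+ n.+1 - 1) *m (C' *m i (y ord0)).
  rewrite big_ord_recl [X in _ = X - _]big_ord_recr /= expr0 mul1mx.
  have -> : ordS ord_max = ord0 :> 'I_n.+1.
    by apply: val_inj; rewrite /= modnn.
  have CK k (v : 'cV_(m + m)) : C ^+ k.+1 *m (C' *m v) = C ^+ k *m v.
    rewrite exprSr -mulmxE -mulmxA; congr (_ *m _).
    by rewrite mulmxA CC' mul1mx.
  rewrite mulmxBl mul1mx CK opprB [RHS]addrC [_ + (C ^+ n *m _)]addrC.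
  rewrite addrA subrK; congr (_ + _); apply: eq_bigr => j _.
  rewrite /bump /= add1n CK; congr (_ *m i (y _)); apply: val_inj => /=.
  by rewrite modn_small ?ltnS.
have cancel (V : zmodType) (x p z q : V) : x + p + (z - q) - z - x = p - q.
  by rewrite addrA [_ - q - z]addrAC addrK addrAC [x + p]addrC addrK.
by rewrite mulmxBr cancel.
Qed.

End Companion.

Section Torus.
Variable n : nat.
Hypothesis n_gt0 : (0 < n)%N.

Let G : mgraph := cart_prod (cycle_graph 4) (cycle_graph n.+1).

Definition of_layers (y : 'I_n.+1 -> 'cV[int]_4) : 'cV[int]_#|G| :=
  \col_i y (enum_val i).2 (enum_val i).1 0.

Lemma of_layersB y z :
  of_layers y - of_layers z = of_layers (fun j => y j - z j).
Proof. by apply/colP => i; rewrite !mxE. Qed.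

Lemma of_layers_surj (v : 'cV[int]_#|G|) : exists y, v = of_layers y.
Proof.
exists (fun j => \col_k v (enum_rank ((k, j) : G)) 0).
by apply/colP => i; rewrite !mxE -surjective_pairing enum_valK.
Qed.

(** The diagonal 4 of [stepC4] counts two neighbours in C_4 and two in the long cycle. *)
Lemma laplacian_of_layers y : laplacian G *m of_layers y =
  of_layers (fun j => stepC4 *m y j - y (ordS j) - y (ord_pred j)).
Proof.
rewrite (laplacian_mulE (fun x : G => y x.2 x.1 0)).
have subE (u v w : 'cV[int]_4) i : (u - v - w) i 0 = u i 0 - v i 0 - w i 0.
  by rewrite !mxE.
apply/colP => i; rewrite [LHS]mxE [RHS]mxE; case: (enum_val i) => k j /=.
rewrite [LHS](_ : _ = \sum_(p : 'I_4 * 'I_n.+1)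
   ((k == p.1)%:Z * ((cycle_mult j p.2)%:Z * (y j k 0 - y p.2 k 0)) +
    (j == p.2)%:Z * ((cycle_mult k p.1)%:Z * (y j k 0 - y j p.1 0)))).
  rewrite big_split /=.
  rewrite -(pair_bigA _ (fun i' j' => (k == i')%:Z * ((cycle_mult j j')%:Z * (y j k 0 - y j' k 0)))) /=.
  rewrite -(pair_bigA _ (fun i' j' => (j == j')%:Z * ((cycle_mult k i')%:Z * (y j k 0 - y j i' 0)))) /=.
  rewrite exchange_big [X in _ + X]exchange_big /=.
  rewrite -[X in X + _ = _]exchange_big.
  have delta (T : finType) (t : T) (F : T -> int) :
      \sum_u (t == u)%:Z * F u = F t.
    rewrite (bigD1 t) //= eqxx mul1r big1 ?addr0 // => u.
    by rewrite eq_sym => /negPf ->; rewrite mul0r.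
  under eq_bigr do rewrite -mulr_sumr.
  under [X in _ + X]eq_bigr do rewrite -mulr_sumr.
  rewrite !delta !cycle_mult_sum ?ltnS //.
  by rewrite subE stepC4E; ring.
apply: eq_bigr => -[k' j'] _ /=; rewrite /cart_mult /= PoszD !PoszM.
have [->|_] := eqVneq k k'; have [->|_] := eqVneq j j'; rewrite /=; ring.
Qed.

(** The index is reduced modulo the length of the cycle, so layers may be numbered by all naturals
    and multiplication by x is the successor. *)
Definition single_layer (k : nat) (v : 'cV[int]_4) (j : 'I_n.+1) : 'cV[int]_4 :=
  if j == (k %% n.+1)%N :> nat then v else 0.

Let Q : zmodType := coker_laplacian G.

Definition coker_class (w : 'cV[int]_#|G|) : Q := \pi_Q w.

Lemma coker_classB v w : coker_class (v - w) = coker_class v - coker_class w.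
Proof. exact: (raddfB (\pi_Q)). Qed.

Lemma coker_class_eq0 v :
  coker_class v = 0 <-> exists w, v = laplacian G *m w.
Proof.
rewrite /coker_class -(raddf0 (\pi_Q)); split => [/eqP|v_im].
  by rewrite -Quotient.idealrBE subr0 => /asboolP.
by apply/eqP; rewrite -Quotient.idealrBE subr0; apply/asboolP.
Qed.

Definition layer_class (k : nat) (v : 'cV[int]_4) : Q :=
  coker_class (of_layers (single_layer k v)).

Lemma layer_classB k v w :
  layer_class k (v - w) = layer_class k v - layer_class k w.
Proof.
rewrite /layer_class -coker_classB of_layersB; congr (coker_class (of_layers _)).
by apply/funext => j; rewrite /single_layer; case: eqP; rewrite ?subrr.
Qed.

(** This is the relation given by the Laplacian of v placed in layer k + 1, that is x^k (a x - x^2 -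
    1) v = 0. *)
Lemma layer_class_step k v :
  layer_class k.+1 (stepC4 *m v) = layer_class k.+2 v + layer_class k v.
Proof.
apply/eqP; rewrite addrC -subr_eq -subr_eq0 /layer_class -!coker_classB.
rewrite !of_layersB; apply/eqP/coker_class_eq0.
exists (of_layers (single_layer k.+1 v)); rewrite laplacian_of_layers.
congr of_layers; apply/funext => j; rewrite [LHS]addrAC.
congr (_ - _ - _); rewrite /single_layer /=.
- by case: eqP => //; rewrite mulmx0.
- rewrite -[in RHS]addn1 -(addn1 k) eqn_modDr.
  by rewrite [X in _ = if X == _ then _ else _]modn_small.
- rewrite addnS /= -(eqn_modDr 1) addn1 -addnS modnDr addn1.
  by rewrite [X in _ = if X == _ then _ else _]modn_small.
Qed.

HB.instance Definition _ k :=
  GRing.isZmodMorphism.Build _ _ (layer_class k) (layer_classB k).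

Lemma layer_class_period k v : layer_class (k + n.+1) v = layer_class k v.
Proof.
by rewrite /layer_class /single_layer modnDr.
Qed.

Lemma coker_class_of_layers y :
  coker_class (of_layers y) = \sum_(j < n.+1) layer_class j (y j).
Proof.
rewrite -(raddf_sum (\pi_Q)); congr coker_class; apply/colP => i.
rewrite summxE (bigD1 (enum_val i).2) //= !mxE /single_layer.
rewrite modn_small // eqxx big1 ?addr0 // => j ji; rewrite !mxE.
by rewrite modn_small // val_eqE eq_sym (negPf ji) mxE.
Qed.

(** The class of x^k (r_0 + r_1 x): by the recurrence, two consecutive layers determine all the
    others. *)
Definition state_class (k : nat) (r : 'cV[int]_(4 + 4)) : Q :=
  layer_class k (usubmx r) + layer_class k.+1 (dsubmx r).

Lemma state_classB k r t :
  state_class k (r - t) = state_class k r - state_class k t.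
Proof.
by rewrite /state_class !raddfB opprD addrACA.
Qed.

Lemma state_class_step k r :
  state_class k (companion stepC4 *m r) = state_class k.+1 r.
Proof.
rewrite -{1}[r]vsubmxK mul_block_col !mul0mx mulNmx !mul1mx add0r.
rewrite /state_class col_mxKu col_mxKd raddfN raddfD /= layer_class_step.
by rewrite addrCA [X in _ + (_ + X)]addrC addKr.
Qed.

HB.instance Definition _ k :=
  GRing.isZmodMorphism.Build _ _ (state_class k) (state_classB k).

Lemma state_class_companionX k j r :
  state_class k (companion stepC4 ^+ j *m r) = state_class (k + j) r.
Proof.
elim: j k => [|j IHj] k; first by rewrite expr0 mul1mx addn0.
by rewrite exprS -mulmxE -mulmxA state_class_step IHj addSnnS.
Qed.

Lemma of_layers_inj : injective of_layers.
Proof.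
move=> y z yz; apply/funext => j; apply/colP => k.
have := congr1 (fun v : 'cV_#|G| => v (enum_rank ((k, j) : G)) 0) yz.
by rewrite !mxE enum_rankK.
Qed.

Lemma coker_laplacian_presentation :
  presentation (fun r => exists t, r = (companion stepC4 ^+ n.+1 - 1) *m t)
    (state_class 0).
Proof.
have embedE k v : layer_class k v = state_class k (col_mx v 0).
  by rewrite /state_class col_mxKu col_mxKd raddf0 addr0.
split; first exact: state_classB.
  move=> x; have [y ey] := of_layers_surj (repr x).
  exists (\sum_(j < n.+1) companion stepC4 ^+ j *m col_mx (y j) 0).
  rewrite raddf_sum /= -[RHS]reprK ey.
  rewrite [RHS]coker_class_of_layers; apply: eq_bigr => j _.
  by rewrite embedE state_class_companionX add0n.
move=> r; split=> [|[t ->]]; last first.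
  rewrite mulmxBl mul1mx raddfB /= state_class_companionX.
  by rewrite /state_class -addSn !layer_class_period subrr.
(* The double sign writes the sum of two layers as a difference, the form in which additivity is
   available. *)
pose z (j : 'I_n.+1) := single_layer 0 (usubmx r) j - single_layer 1 (- dsubmx r) j.
have -> : state_class 0 r = coker_class (of_layers z).
  by rewrite -of_layersB coker_classB -!/(layer_class _ _) raddfN opprK.
case/coker_class_eq0 => w; have [y ->] := of_layers_surj w.
rewrite laplacian_of_layers => /of_layers_inj ez.
(* The witness is the boundary term left by the telescoping sum. *)
exists (col_mx (y ord_max) 0 - companionV stepC4 *m col_mx (y ord0) 0).
rewrite -companion_cyclic_sum.
transitivity (\sum_(j < n.+1) companion stepC4 ^+ j *m col_mx (z j) 0); last first.
  by rewrite ez.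
(* Since n > 0, layers 0 and 1 are distinct; [z] lives on these two, and its weighted sum is r. *)
pose j1 : 'I_n.+1 := Ordinal (n_gt0 : (1 < n.+1)%N).
rewrite (bigD1 ord0) // (bigD1 j1) //= big1 => [|j /andP[j0 jj1]].
  rewrite /z /single_layer /= !modn_small //=.
  rewrite subr0 expr0 mul1mx expr1.
  rewrite sub0r opprK mul_block_col !mul0mx !mulmx0 mul1mx !addr0 add_col_mx.
  by rewrite addr0 add0r vsubmxK.
rewrite /z /single_layer !modn_small // [_ == 0%N](negPf j0) [_ == 1%N](negPf jj1).
by rewrite subr0 col_mx0 mulmx0.
Qed.

End Torus.

(** * Equivalence of integer matrices at a prime *)

Section LocalEquivalence.
Variable p : nat.
Hypothesis p_prime : prime p.

(** Equivalence over Z_(p) with denominators cleared: P and Q are integral and invertible modulo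
    p. *)
Definition pequiv m (A B : 'M[int]_m) : Prop :=
  exists P Q, [/\ ~~ (p %| \det P)%Z, ~~ (p %| \det Q)%Z & P *m A = B *m Q].

Lemma dvdz_primeM (x y : int) : (p %| x * y)%Z = (p %| x)%Z || (p %| y)%Z.
Proof. by rewrite !dvdzE abszM absz_nat Euclid_dvdM. Qed.

Lemma dvdz_prime1 : (p %| 1%R)%Z = false.
Proof. by rewrite dvdzE absz_nat dvdn1; case: p p_prime => [|[|]]. Qed.

Lemma dvdz_det_unitmx m (L : 'M[int]_m) : L \in unitmx -> ~~ (p %| \det L)%Z.
Proof.
move=> Lu; apply: contraFN dvdz_prime1 => pL.
by rewrite -(det1 int m) -(mulmxV Lu) det_mulmx dvdz_mulr.
Qed.

Lemma pequiv_refl m (A : 'M[int]_m) : pequiv A A.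
Proof.
by exists 1%:M, 1%:M; rewrite mul1mx mulmx1 det1 dvdz_prime1.
Qed.

Lemma pequiv_trans m (B A C : 'M[int]_m) : pequiv A B -> pequiv B C -> pequiv A C.
Proof.
move=> [P [Q [pP pQ PQ]]] [P' [Q' [pP' pQ' PQ']]].
exists (P' *m P), (Q' *m Q); rewrite !det_mulmx !dvdz_primeM !negb_or.
by rewrite pP pQ pP' pQ' -mulmxA PQ mulmxA PQ' mulmxA.
Qed.

(** Adjugates stand in for inverses: multiplying P A = B Q by adj P on the left and adj Q on the
    right gives det P * A * adj Q = det Q * adj P * B. *)
Lemma pequiv_sym m (A B : 'M[int]_m) : pequiv A B -> pequiv B A.
Proof.
case: m A B => [|m] A B; first by move=> _; rewrite [A]thinmx0 [B]thinmx0; apply: pequiv_refl.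
have pX k (x : int) : ~~ (p %| x)%Z -> ~~ (p %| x ^+ k)%Z.
  by move=> px; elim: k => [|k IHk]; rewrite ?dvdz_prime1 // exprS dvdz_primeM negb_or px.
have det_adj (P : 'M[int]_m.+1) : ~~ (p %| \det P)%Z -> ~~ (p %| \det (\adj P))%Z.
  move=> pP; have := congr1 determinant (mul_mx_adj P).
  rewrite det_mulmx det_scalar => e; apply: contra (pX m.+1 _ pP) => pA.
  by rewrite -e dvdz_mull.
move=> [P [Q [pP pQ PQ]]].
exists (\det Q *: \adj P), (\det P *: \adj Q).
rewrite !detZ !dvdz_primeM !negb_or !det_adj // !andbT.
split; [exact: pX | exact: pX | ].
have -> : \det Q *: \adj P *m B = \adj P *m (B *m Q) *m \adj Q.
  by rewrite -!mulmxA mul_mx_adj mul_mx_scalar -scalemxAr scalemxAl.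
rewrite -PQ mulmxA mul_adj_mx mul_scalar_mx -!scalemxAl.
by rewrite scalemxAr.
Qed.

Lemma pequiv_unit m (L R A B : 'M[int]_m) :
  L \in unitmx -> R \in unitmx -> L *m A = B *m R -> pequiv A B.
Proof. by move=> Lu Ru e; exists L, R; rewrite !dvdz_det_unitmx. Qed.

End LocalEquivalence.

(** The shape in which the integer Smith normal form is delivered; entries past the end of [d] read
    as 0. *)
Definition diagz m (d : seq int) : 'M[int]_m :=
  \matrix_(i, j) (d`_i *+ (i == j :> nat)).

(** Pigeonhole: otherwise s would inject the indices >= i into those > i. *)
Lemma perm_crossing m (s : 'S_m) (i : 'I_m) : exists2 k : 'I_m, (i <= k)%N & (s k <= i)%N.
Proof.
apply/exists_inP/negbNE/negP => /exists_inPn cross.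
pose S := [set k : 'I_m | (i <= k)%N].
have : (#|s @: S| <= #|S :\ i|)%N.
  apply/subset_leq_card/subsetP => _ /imsetP[k kS ->].
  have ik : (i <= k)%N by rewrite inE in kS.
  have := cross k ik; rewrite !inE -ltnNge => i_sk.
  by rewrite (ltnW i_sk) andbT -val_eqE neq_ltn i_sk orbT.
rewrite card_imset; last exact: perm_inj.
by rewrite [X in (X <= _)%N](cardsD1 i) inE leqnn ltnn.
Qed.

Lemma sorted_dvdz_nth (d : seq int) (i j : nat) :
  sorted dvdz d -> (i <= j)%N -> (d`_i %| d`_j)%Z.
Proof.
move=> sd ij; have [jd|dj] := ltnP j (size d); last by rewrite [d`_j]nth_default ?dvdz0.
apply: sorted_leq_nth; rewrite ?inE //; try exact: leq_ltn_trans jd.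
  by move=> y x z; apply: dvdz_trans.
by move=> x; apply: dvdzz.
Qed.

(* If [p ^ k] divided [d'_i] but not [d_i], the block of [P] with rows [>= i]
   and columns [<= i] would vanish mod [p], which forces [p] to divide [det P]. *)
Lemma pequiv_diagz_dvd p m (d d' : seq int) (i : 'I_m) k :
  prime p -> sorted dvdz d -> sorted dvdz d' ->
  pequiv p (diagz m d) (diagz m d') ->
  (p%:Z ^+ k %| d'`_i)%Z -> (p%:Z ^+ k %| d`_i)%Z.
Proof.
move=> p_prime sd sd' [P [Q [pP _ PQ]]] pd'.
apply/negPn/negP => pd; case/negP: pP.
rewrite /determinant; apply: rpred_sum => s _.
have [l il sl] := perm_crossing s i.
rewrite (bigD1 l) //= mulrCA dvdz_mulr //.
have e : P l (s l) * d`_(s l) = d'`_l * Q l (s l).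
  have := congr1 (fun M : 'M_m => M l (s l)) PQ.
  rewrite !mxE (bigD1 (s l)) //= !mxE eqxx mulr1n big1 ?addr0 => [->|j].
    rewrite (bigD1 l) //= !mxE eqxx mulr1n big1 ?addr0 // => j.
    by rewrite !mxE val_eqE eq_sym => /negPf ->; rewrite mulr0n mul0r.
  by rewrite !mxE val_eqE => /negPf ->; rewrite mulr0n mulr0.
apply/negPn/negP => pP; case/negP: pd.
apply: (dvdz_trans _ (sorted_dvdz_nth sd sl)).
have : (p%:Z ^+ k %| P l (s l) * d`_(s l))%Z.
  by rewrite e dvdz_mulr // (dvdz_trans pd') // sorted_dvdz_nth.
rewrite Gauss_dvdzr // coprimezE abszX coprimeXl //.
by rewrite prime_coprime // -dvdzE.
Qed.

Lemma eqn_prime_powers (a b : nat) :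
  (forall p k, prime p -> (p ^ k %| a)%N = (p ^ k %| b)%N) -> a = b.
Proof.
move=> ab.
have zero c : (forall k, (2 ^ k %| c)%N) -> c = 0%N.
  move=> c2; case: c c2 => // c c2.
  by have := dvdn_leq (ltn0Sn c) (c2 c.+1); rewrite leqNgt ltn_expl.
have [a0|a_gt0] := posnP a.
  by rewrite a0; apply/esym/zero => k; rewrite -ab // a0 dvdn0.
have [b0|b_gt0] := posnP b.
  by rewrite b0; apply/zero => k; rewrite ab // b0 dvdn0.
apply: eqn_from_log => // p.
have [p_prime|pNprime] := boolP (prime p); last by rewrite /logn (negPf pNprime).
apply/eqP; rewrite eqn_leq; apply/andP; split.
  by rewrite -pfactor_dvdn // -ab // pfactor_dvdn.
by rewrite -pfactor_dvdn // ab // pfactor_dvdn.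
Qed.

(** In the two Smith normal forms, corresponding entries are divisible by the same prime powers, by
    [pequiv_diagz_dvd] in both directions, so they agree up to sign. *)
Lemma local_equiv_global m (A B : 'M[int]_m) :
  (forall p, prime p -> pequiv p A B) ->
  exists U V, [/\ U \in unitmx, V \in unitmx & B = U *m A *m V].
Proof.
move=> AB.
have [L Lu [R Ru [d sd eA]]] := int_Smith_normal_form A.
have [L' Lu' [R' Ru' [d' sd' eB]]] := int_Smith_normal_form B.
rewrite -/(diagz m d) in eA; rewrite -/(diagz m d') in eB.
have dd p : prime p -> pequiv p (diagz m d) (diagz m d').
  move=> p_prime; apply: (@pequiv_trans _ p_prime _ A).
    apply/pequiv_sym => //.
    apply: (@pequiv_unit _ p_prime _ (invmx L) R); rewrite ?unitmx_inv //.
    by rewrite eA -!mulmxA mulKmx.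
  apply: pequiv_trans (AB p p_prime) _ => //.
  apply: (@pequiv_unit _ p_prime _ (invmx L') R'); rewrite ?unitmx_inv //.
  by rewrite eB -!mulmxA mulKmx.
have absd (i : 'I_m) : absz d`_i = absz d'`_i.
  apply: eqn_prime_powers => p k p_prime.
  have dvE (x : int) : (p ^ k %| `|x|)%N = (p%:Z ^+ k %| x)%Z.
    by rewrite dvdzE abszX.
  rewrite !dvE; apply/idP/idP; last exact/pequiv_diagz_dvd/dd.
  by apply: pequiv_diagz_dvd => //; apply/pequiv_sym/dd.
(* Smith factors over Z are unique only up to sign; [S] corrects the signs. *)
pose S : 'M[int]_m := diag_mx (\row_(j < m) (-1) ^+ (d`_j != d'`_j)).
have SE : diagz m d' = S *m diagz m d.
  apply/matrixP => i j; rewrite mul_diag_mx !mxE val_eqE.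
  have [_|_] := eqVneq i j; last by rewrite mulr0n mulr0.
  rewrite !mulr1n; have := absd i; have [->|dd'] := eqVneq d`_i d'`_i.
    by rewrite mul1r.
  by rewrite expr1 mulN1r; lia.
have Su : S \in unitmx.
  rewrite unitmxE det_diag; apply: rpred_prod => j _.
  by rewrite mxE rpredX // rpredN rpred1.
exists (L' *m S *m invmx L), (invmx R *m R'); split.
- by rewrite !unitmx_mul Lu' Su unitmx_inv.
- by rewrite unitmx_mul unitmx_inv Ru.
by rewrite eA eB SE -!mulmxA mulKmx // mulKVmx.
Qed.

Lemma presentation_equiv m (X : zmodType) (A U V : 'M[int]_m) (f : 'cV[int]_m -> X) :
  U \in unitmx -> V \in unitmx ->
  presentation (fun x => exists t, x = A *m t) f ->
  presentation (fun x => exists t, x = (U *m A *m V) *m t) (f \o mulmx (invmx U)).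
Proof.
move=> Uu Vu [fB f_surj fK]; split=> [x y|x|x] /=; first by rewrite mulmxBr fB.
  by have [v <-] := f_surj x; exists (U *m v); rewrite mulKmx.
rewrite fK; split=> [[t et]|[t ->]].
  by exists (invmx V *m t); rewrite -!mulmxA mulKVmx // -et mulKVmx.
by exists (V *m t); rewrite -!mulmxA mulKmx.
Qed.

Lemma Zmod_pi_eq0 (d : nat) (x : int) :
  (\pi_(Zmod d) x == 0) = (d %| x)%Z.
Proof. by rewrite -(raddf0 \pi_(Zmod d)) -Quotient.idealrBE subr0. Qed.

Lemma diagz_imP m (d : seq int) (x : 'cV[int]_m) :
  (exists t, x = diagz m d *m t) <-> forall i : 'I_m, (d`_i %| x i 0%R)%Z.
Proof.
have E (t : 'cV[int]_m) i : (diagz m d *m t) i 0 = d`_i * t i 0.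
  rewrite mxE (bigD1 i) //= !mxE eqxx mulr1n big1 ?addr0 // => j.
  by rewrite !mxE val_eqE eq_sym => /negPf ->; rewrite mulr0n mul0r.
split=> [[t -> i]|dx]; first by rewrite E dvdz_mulr.
exists (\col_i (x i 0%R %/ d`_i)%Z); apply/colP => i.
by rewrite E mxE mulrC divzK.
Qed.

Lemma diagz_presentation (d0 d1 d2 d3 d4 d5 d6 : nat) :
  presentation
    (fun x : 'cV[int]_8 => exists t, x =
       diagz 8 [:: d0%:Z; d1%:Z; d2%:Z; d3%:Z; d4%:Z; d5%:Z; d6%:Z; 0] *m t)
    (fun x => let c k := x (inord k) 0 in
       (\pi_(Zmod d0) (c 0), \pi_(Zmod d1) (c 1), \pi_(Zmod d2) (c 2),
        \pi_(Zmod d3) (c 3), \pi_(Zmod d4) (c 4), \pi_(Zmod d5) (c 5),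
        \pi_(Zmod d6) (c 6), c 7)%N : 
       (Zmod d0 \oplus Zmod d1 \oplus Zmod d2 \oplus Zmod d3 \oplus Zmod d4
         \oplus Zmod d5 \oplus Zmod d6) * int)%type.
Proof.
split=> [x y|x|x] /=.
- by rewrite !mxE !raddfB.
- case: x => [[[[[[[x0 x1] x2] x3] x4] x5] x6] x7].
  exists (\col_i ([:: repr x0; repr x1; repr x2; repr x3; repr x4; repr x5;
    repr x6; x7] : seq int)`_i).
  by rewrite !mxE !inordK //= !reprK.
rewrite diagz_imP; split=> [[]|dx].
  move=> /eqP + /eqP + /eqP + /eqP + /eqP + /eqP + /eqP +.
  rewrite !Zmod_pi_eq0 => d0x d1x d2x d3x d4x d5x d6x x7.
  case=> [[|[|[|[|[|[|[|[|i]]]]]]]] lti] //=; rewrite -(inord_val (Ordinal lti)) //=.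
  by rewrite x7.
have dxk k : (k < 8)%N -> 
   ([:: d0%:Z; d1%:Z; d2%:Z; d3%:Z; d4%:Z; d5%:Z; d6%:Z; 0]`_k %| x (inord k) 0%R)%Z.
  by move=> lt_k; have := dx (inord k); rewrite inordK.
have := dxk 7%N isT; rewrite /= dvd0z => /eqP ->.
by repeat congr pair; apply/eqP; rewrite Zmod_pi_eq0; [apply: (dxk 0)|
  apply: (dxk 1)| apply: (dxk 2)| apply: (dxk 3)| apply: (dxk 4)|
  apply: (dxk 5)| apply: (dxk 6)].
Qed.

Lemma Zmod_muln (d : nat) (x : Zmod d) : x *+ d = 0.
Proof.
rewrite -[x]reprK -raddfMn; apply/eqP; rewrite Zmod_pi_eq0.
by rewrite -mulr_natr natz dvdz_mull.
Qed.

Lemma dsum_mulrn_eq0 (A B : zmodType) k :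
  (forall x : A, x *+ k = 0) -> (forall x : B, x *+ k = 0) ->
  forall x : A \oplus B, x *+ k = 0.
Proof.
move=> kA kB [x y]; apply/eqP; rewrite -pair_eqE /= !raddfMn /=.
by rewrite kA kB !eqxx.
Qed.

Lemma critical_group_torus (n d0 d1 d2 d3 d4 d5 d6 : nat) :
  (0 < n)%N -> all (leq 1) [:: d0; d1; d2; d3; d4; d5; d6] ->
  (forall p, prime p -> pequiv p (companion stepC4 ^+ n.+1 - 1)
     (diagz 8 [:: d0%:Z; d1%:Z; d2%:Z; d3%:Z; d4%:Z; d5%:Z; d6%:Z; 0])) ->
  critical_group (cart_prod (cycle_graph 4) (cycle_graph n.+1)) \simeq
    Zmod d0 \oplus Zmod d1 \oplus Zmod d2 \oplus Zmod d3 \oplus Zmod d4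
      \oplus Zmod d5 \oplus Zmod d6.
Proof.
move=> n_gt0 d_gt0 /local_equiv_global[U [V [Uu Vu eUV]]].
have pres := presentation_equiv Uu Vu (coker_laplacian_presentation n_gt0).
rewrite -eUV in pres.
apply: zmod_iso_trans (torsion_iso (presentation_iso pres _)) _.
  exact: diagz_presentation.
apply: torsion_prod_int; exists (d0 * d1 * d2 * d3 * d4 * d5 * d6)%N.
  by rewrite !muln_gt0; move: d_gt0 => /=; do 7! case/andP => ->.
have kill d k : (d %| k)%N -> forall x : Zmod d, x *+ k = 0.
  by case/dvdnP=> q -> x; rewrite mulnC mulrnA Zmod_muln mul0rn.
do 6?[apply: dsum_mulrn_eq0; last first]; apply: kill;
  by do ?[exact: dvdn_mull | apply: dvdn_mulr].
Qed.

(** * Chebyshev-type recurrences *)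

(* The sequence [0, 1, b, b^2 - 1, ...], that is [U_(k-1)(b/2)] for the Chebyshev
   polynomials of the second kind; locked to keep unification from unfolding it. *)
Definition chebU (R : pzRingType) (b : R) (k : nat) : R :=
  locked (iter k (fun z => (z.2, b * z.2 - z.1)) (0, 1)).1.

Section Chebyshev.
Variable R : pzRingType.
Implicit Types b x y : R.

Lemma chebU0 b : chebU b 0 = 0. Proof. by rewrite /chebU -lock. Qed.

Lemma chebU1 b : chebU b 1 = 1. Proof. by rewrite /chebU -lock. Qed.

Lemma chebU_rec b k : chebU b k.+2 = b * chebU b k.+1 - chebU b k.
Proof. by rewrite /chebU -!lock. Qed.

(** The ring may be noncommutative: the coefficient b acts on the left, so the initial value c
    factors out on the right. *)
Lemma chebU_unique b (x : nat -> R) c :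
  x 0%N = 0 -> x 1%N = c -> (forall k, x k.+2 = b * x k.+1 - x k) ->
  forall k, x k = chebU b k * c.
Proof.
move=> x0 x1 xrec k; have [] : x k = chebU b k * c /\ x k.+1 = chebU b k.+1 * c.
  elim: k => [|k [IH0 IH1]]; first by rewrite chebU0 chebU1 mul0r mul1r.
  by rewrite xrec IH0 IH1 chebU_rec mulrBl mulrA.
by [].
Qed.

Lemma chebU_comm b x k : GRing.comm x b -> GRing.comm x (chebU b k).
Proof.
move=> xb; have [] : GRing.comm x (chebU b k) /\ GRing.comm x (chebU b k.+1).
  elim: k => [|k [IH0 IH1]]; first by rewrite chebU0 chebU1; split; [apply: commr0 | apply: commr1].
  by split=> //; rewrite chebU_rec; apply: commrB => //; apply: commrM.
by [].
Qed.

Lemma chebU_intertwine b b' x k : x * b = b' * x -> x * chebU b k = chebU b' k * x.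
Proof.
move=> xb; have [] : x * chebU b k = chebU b' k * x /\
    x * chebU b k.+1 = chebU b' k.+1 * x.
  elim: k => [|k [IH0 IH1]]; first by rewrite !chebU0 !chebU1 mulr0 mul0r mulr1 mul1r.
  by split=> //; rewrite !chebU_rec mulrBr mulrBl mulrA xb -!mulrA IH1 IH0.
by [].
Qed.

(** If b = x + x^-1, then b^2 - 2 = x^2 + x^-2: taking every second term replaces x by its
    square. *)
Lemma chebU_step2 b k : chebU b k.+4 = (b ^+ 2 - 2) * chebU b k.+2 - chebU b k.
Proof.
have -> : chebU b k = b * chebU b k.+1 - chebU b k.+2 by rewrite chebU_rec subKr.
rewrite (chebU_rec b k.+2) (chebU_rec b k.+1) mulrBr mulrBl mulrA -expr2.
rewrite mulr_natl mulr2n opprB !opprD !addrA. by rewrite subrK addrAC.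
Qed.

Lemma chebU_double b k : chebU b k.*2 = b * chebU (b ^+ 2 - 2) k.
Proof.
rewrite (@chebU_unique (b ^+ 2 - 2) (fun k => chebU b k.*2) b) ?chebU0 //.
- by apply/commr_sym/chebU_comm; apply: commrB;
    [apply: commrX; apply: commr_refl | apply: commr_nat].
- by rewrite chebU_rec chebU1 chebU0 mulr1 subr0.
- by move=> j; apply: chebU_step2.
Qed.

Let negD2 : - 2 = - 1 - 1 :> R.
Proof. by rewrite -opprD. Qed.

Lemma chebU_even_arg y k : exists q r,
  chebU (2 * y) k.*2 = 2 * q /\ chebU (2 * y) k.*2.+1 = 1 + 2 * r.
Proof.
elim: k => [|k [q [r [eq er]]]]; first by exists 0, 0; rewrite chebU0 chebU1 mulr0 addr0.
pose q' := y * chebU (2 * y) k.*2.+1 - q.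
have eq' : chebU (2 * y) k.*2.+2 = 2 * q' by rewrite chebU_rec eq mulrBr mulrA.
exists q', (y * (2 * q') - r - 1); split=> //.
rewrite doubleS chebU_rec eq' er !mulrBr mulrA.
rewrite mulr1 opprD addrA addrAC [RHS]addrC -[RHS]addrA; congr (_ + _).
  by rewrite !mulrA.
by rewrite negD2 subrK.
Qed.

(** For odd k the value is 1 modulo 2. For k = 2j it is 2y times the j-th value at 4y^2 - 2 = 2(2y^2
    - 1), and 2y^2 - 1 is again 1 modulo 2, so induction applies. [unit2] is oddness for integers
    and odd determinant for matrices. *)
Lemma chebU_2adic (unit2 : R -> Prop) :
  (forall x y, unit2 x -> unit2 y -> unit2 (x * y)) ->
  (forall q, unit2 (1 + 2 * q)) ->
  forall k y, (0 < k)%N -> unit2 y ->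
    exists2 x, unit2 x & chebU (2 * y) k = 2 ^+ logn 2 k * x.
Proof.
move=> unit2M unit2_1; elim/ltn_ind=> k IHk y k_gt0 y_unit.
have [k_odd|k_even] := boolP (odd k).
  have -> : logn 2 k = 0%N by rewrite lognE dvdn2 k_odd andbF.
  have [q [r [_ e]]] := chebU_even_arg y k./2.
  exists (1 + 2 * r) => //; rewrite mul1r -e.
  by rewrite -[k in LHS]odd_double_half k_odd.
have ek : k = k./2.*2 by rewrite -[LHS]odd_double_half (negPf k_even).
have j_gt0 : (0 < k./2)%N by lia.
pose y' := 1 + 2 * (y ^+ 2 - 1).
have lt_jk : (k./2 < k)%N by lia.
have [x x_unit ex] := IHk _ lt_jk y' j_gt0 (unit2_1 _).
exists (y * x); first exact: unit2M.
have c2 n (z : R) : GRing.comm z (2 ^+ n) by apply/commrX/commr_nat.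
have -> : logn 2 k = (logn 2 k./2).+1.
  by rewrite [in LHS]ek -muln2 lognM // (@logn_prime 2 2) // addn1.
rewrite [X in chebU _ X]ek chebU_double.
have -> : (2 * y) ^+ 2 - 2 = 2 * y'.
  rewrite /y' exprMn_comm; last exact/commr_sym/commr_nat.
  have -> : 1 + 2 * (y ^+ 2 - 1) = 2 * y ^+ 2 - 1.
    by rewrite mulrBr mulr1 addrCA negD2 addNKr.
  by rewrite mulrBr mulr1 mulrA -expr2.
by rewrite ex exprS -!mulrA [y * _]mulrA [in LHS](c2 _ y) -mulrA.
Qed.

End Chebyshev.

Lemma chebU_add (R : comPzRingType) (b : R) m k :
  chebU b (m + k) =
    chebU b m.+1 * chebU b k + chebU b m * chebU b k.+1 - b * chebU b m * chebU b k.
Proof.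
have [] // : chebU b (m + k) =
    chebU b m.+1 * chebU b k + chebU b m * chebU b k.+1 - b * chebU b m * chebU b k
  /\ chebU b (m.+1 + k) =
    chebU b m.+2 * chebU b k + chebU b m.+1 * chebU b k.+1 - b * chebU b m.+1 * chebU b k.
elim: m => [|m [IH0 IH1]].
  by rewrite add0n add1n !chebU_rec chebU1 chebU0; split; ring.
split=> //; rewrite !addSn (chebU_rec b (m + k)) -!addSn IH0 IH1.
by rewrite !(chebU_rec b m.+1, chebU_rec b m); ring.
Qed.

Lemma chebU_cassini (R : comPzRingType) (b : R) k :
  chebU b k.+1 ^+ 2 - b * chebU b k * chebU b k.+1 + chebU b k ^+ 2 = 1.
Proof.
elim: k => [|k IHk]; first by rewrite chebU0 chebU1; ring.
by rewrite -[RHS]IHk chebU_rec; ring.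
Qed.

(** With b = x + x^-1 and X = x^k this is X^3 - X^-3 = (X - X^-1)((X - X^-1)^2 + 3), where (x -
    x^-1)^2 = b^2 - 4. *)
Lemma chebU_triple (R : comPzRingType) (b : R) k :
  chebU b (3 * k) = chebU b k * ((b ^+ 2 - 4) * chebU b k ^+ 2 + 3).
Proof.
rewrite (_ : 3 * k = k + k + k)%N; last lia.
rewrite chebU_add -addSn !chebU_add !chebU_rec.
set x := chebU b k; set y := chebU b k.+1.
(* The bracket is the Cassini expression, equal to 1. *)
transitivity (3 * x * (y ^+ 2 - b * x * y + x ^+ 2) + (b ^+ 2 - 4) * x ^+ 3).
  by ring.
by rewrite chebU_cassini; ring.
Qed.

Lemma uN_chebU m k : (0 < m)%N -> (uN m k)%:Z = chebU (m%:Z + 2) k.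
Proof.
move=> m_gt0.
rewrite (@chebU_unique _ (m%:Z + 2) (fun k => (uN m k)%:Z) 1) ?mulr1 //.
- by rewrite uN0.
- by rewrite uN1.
by move=> j; have := uN_rec m_gt0 j; lia.
Qed.

Lemma uN_ltS m k : (0 < m)%N -> (uN m k < uN m k.+1)%N.
Proof.
move=> m_gt0; elim: k => [|k IHk]; first by rewrite uN0 // uN1.
by have := uN_rec m_gt0 k; nia.
Qed.

Lemma uN_gt0 m k : (0 < m)%N -> (0 < k)%N -> (0 < uN m k)%N.
Proof. by move=> m_gt0; case: k => // k _; apply: leq_ltn_trans (uN_ltS k m_gt0). Qed.

Lemma e_chebU k : (e_ k)%:Z = chebU 4 k.
Proof. exact: uN_chebU. Qed.

Lemma f_chebU k : (f_ k)%:Z = chebU 6 k.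
Proof. exact: uN_chebU. Qed.

Lemma h_chebU k : (h_ k)%:Z = chebU 4 k + chebU 4 k.+1.
Proof. by rewrite PoszD !e_chebU. Qed.

Lemma g_chebU k : (g_ k)%:Z = chebU 6 k + chebU 6 k.+1.
Proof. by rewrite PoszD !f_chebU. Qed.

Lemma chebU_2 k : chebU (2 : int) k = k%:Z.
Proof.
rewrite -[LHS]mulr1; apply/esym.
by apply: (@chebU_unique _ (2 : int) (fun k => k%:Z) 1) => // j; lia.
Qed.

Lemma uN_odd m k : (0 < m)%N -> ~~ odd m -> odd (uN m k) = odd k.
Proof.
move=> m_gt0 m_even.
have [] // : odd (uN m k) = odd k /\ odd (uN m k.+1) = ~~ odd k.
elim: k => [|k [IH0 IH1]]; first by rewrite uN0 // uN1.
split=> //; have := uN_rec m_gt0 k; move/(congr1 odd).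
by rewrite oddD oddM oddD (negPf m_even) /= IH0; case: odd => //; case: odd.
Qed.

Lemma chebU_int_2adic (y : int) k : (0 < k)%N -> ~~ (2 %| y)%Z ->
  exists2 x, ~~ (2 %| x)%Z & chebU (2 * y) k = 2 ^+ logn 2 k * x.
Proof.
move=> k_gt0 y_odd; pose unit2 (x : int) := ~~ (2 %| x)%Z.
apply: (@chebU_2adic int unit2) => //; rewrite /unit2.
  by move=> u v; rewrite !dvdzE abszM Euclid_dvdM // negb_or => -> ->.
by move=> q; lia.
Qed.

Lemma logn2_mul (a : nat) (c j : nat) (x : int) :
  (0 < c)%N -> ~~ (2 %| x)%Z -> a%:Z = c%:Z * (2 ^+ j * x) -> logn 2 a = (logn 2 c + j)%N.
Proof.
move=> c_gt0 x_odd ea.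
have -> : a = (c * (2 ^ j * `|x|))%N.
  by rewrite -[LHS]absz_nat ea !abszM abszX.
have x_odd' : ~~ (2 %| `|x|)%N by rewrite dvdzE in x_odd.
have x_gt0 : (0 < `|x|)%N by case: `|x|%N x_odd'.
rewrite !lognM ?muln_gt0 ?expn_gt0 // lognX (@logn_prime 2 2) // muln1.
by rewrite [logn 2 `|x|]lognE (negPf x_odd') andbF addn0.
Qed.

(** Doubling gives e_(2k) = 4 U_k(14), with 14 = 4^2 - 2 = 2 * 7 and 7 odd. *)
Lemma logn2_e_double k : (0 < k)%N -> logn 2 (e_ k.*2) = (2 + logn 2 k)%N.
Proof.
move=> k_gt0; have [|x x_odd ex] := @chebU_int_2adic 7 k k_gt0; first by [].
by apply: (@logn2_mul _ 4 _ x) => //; rewrite e_chebU chebU_double -ex.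
Qed.

(** Likewise f_(2k) = 6 U_k(34), with 34 = 6^2 - 2 = 2 * 17. *)
Lemma logn2_f_double k : (0 < k)%N -> logn 2 (f_ k.*2) = (1 + logn 2 k)%N.
Proof.
move=> k_gt0; have [|x x_odd ex] := @chebU_int_2adic 17 k k_gt0; first by [].
by apply: (@logn2_mul _ 6 _ x) => //; rewrite f_chebU chebU_double -ex.
Qed.

(** Modulo 3 the coefficient 4 is 1, whence e_(k+3) = - e_k. *)
Lemma dvd3_e k : (3 %| e_ k)%N = (3 %| k)%N.
Proof.
suff: [/\ (3 %| e_ k)%N = (3 %| k)%N, (3 %| e_ k.+1)%N = (3 %| k.+1)%N
        & (3 %| e_ k.+2)%N = (3 %| k.+2)%N] by case.
elim: k => [|k [IH0 IH1 IH2]].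
  by have := uN_rec (isT : 0 < 2)%N 0; rewrite /e_ uN0 // uN1 // => ?; split; lia.
split=> //; have -> : (3 %| k.+3)%N = (3 %| e_ k)%N by rewrite IH0; lia.
have := uN_rec (isT : 0 < 2)%N k; have := uN_rec (isT : 0 < 2)%N k.+1.
by rewrite /e_; lia.
Qed.

Lemma e_triple k : e_ (3 * k) = (3 * (e_ k * (4 * e_ k ^ 2 + 1)))%N.
Proof.
apply: (can_inj absz_nat); have := chebU_triple (4 : int) k.
rewrite -!e_chebU => ->; lia.
Qed.

(** In the tripling formula the cofactor 4 e^2 + 1 is prime to 3, because -1 is not a square modulo
    3; each tripling adds exactly one factor 3. *)
Lemma logn3_e k : (0 < k)%N -> logn 3 (e_ k) = logn 3 k.
Proof.
elim/ltn_ind: k => k IHk k_gt0.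
have [/dvdnP[j ej]|k3] := boolP (3 %| k)%N; last first.
  by rewrite [LHS]lognE [RHS]lognE dvd3_e (negPf k3) !andbF.
have j_gt0 : (0 < j)%N by lia.
have e_gt0 : (0 < e_ j)%N by apply: uN_gt0.
have cofactor : logn 3 (4 * e_ j ^ 2 + 1) = 0%N.
  have : ((e_ j ^ 2) %% 3 != 2)%N.
    rewrite -modnXm; have := ltn_pmod (e_ j) (isT : 0 < 3)%N.
    by case: (e_ j %% 3)%N => [|[|[]]].
  move: (e_ j ^ 2)%N => q q3; rewrite lognE (_ : (3 %| _)%N = false) ?andbF //; lia.
rewrite ej mulnC e_triple !lognM ?muln_gt0 ?e_gt0 ?addn_gt0 ?orbT //.
by rewrite cofactor addn0 IHk //; lia.
Qed.

(** In f_(2k) = 6 U_k(34) the factor 6 supplies the strict inequality. Since 3 divides 34^2 - 4,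
    each tripling of the index adds at least one factor 3 to U_k(34). *)
Lemma logn3_f_double k : (0 < k)%N -> (logn 3 k.*2 < logn 3 (f_ k.*2))%N.
Proof.
move=> k_gt0; have f_gt0 : (0 < f_ k.*2)%N by apply: uN_gt0; lia.
rewrite -pfactor_dvdn // -muln2 lognM // [logn 3 2]lognE addn0 muln2.
have dvd j : (3%:Z ^+ logn 3 j %| chebU 34 j)%Z.
  elim/ltn_ind: j => j IHj.
  have [/dvdnP[i ei]|j3] := boolP (3 %| j)%N; last first.
    by rewrite lognE (negPf j3) !andbF dvd1z.
  have [i0|i_gt0] := posnP i; first by rewrite ei i0 dvd1z.
  rewrite ei mulnC lognM // (@logn_prime 3 3) // add1n exprSr chebU_triple.
  apply: dvdz_mul; last by lia.
  by apply: IHj; lia.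
have e_f : f_ k.*2 = (6 * `|chebU 34 k|)%N.
  by rewrite -[LHS]absz_nat f_chebU chebU_double abszM.
rewrite e_f expnS -[6%N]/(3 * 2)%N -mulnA dvdn_pmul2l // dvdn_mull //.
by have := dvd k; rewrite dvdzE abszX.
Qed.

(** Modulo 3 the coefficient 6 vanishes, so f_(k+2) = - f_k, starting from f_1 = 1. *)
Lemma ndvd3_f_odd k : odd k -> ~~ (3 %| f_ k)%N.
Proof.
move=> k_odd; have -> : k = k./2.*2.+1 by lia.
elim: k./2 => [|j IHj]; first by rewrite /f_ uN1.
by rewrite doubleS; have := uN_rec (isT : 0 < 4)%N j.*2.+1; rewrite /f_ in IHj *; lia.
Qed.

(** * Reduction to constant matrices *)

Section CompanionPowers.
Variable m : nat.
Implicit Types a b : 'M[int]_m.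

Lemma diag2_chebU a k : diag2 (chebU a k) = chebU (diag2 a) k.
Proof.
rewrite -[RHS]mulr1; apply: (@chebU_unique _ (diag2 a) (fun k => diag2 (chebU a k)) 1).
- by rewrite chebU0 /diag2 block_mx0.
- by rewrite chebU1 /diag2 [RHS]block1.
- by move=> j; rewrite chebU_rec diag2B -diag2M.
Qed.

Lemma companionX_rec a k : companion a ^+ k.+2 =
  diag2 a * companion a ^+ k.+1 - companion a ^+ k.
Proof.
rewrite -companionD mulrDl -exprS [companion a ^+ k.+1]exprS mulrA companionK mul1r.
by rewrite addrK.
Qed.

Lemma companionVX_rec a k : companionV a ^+ k.+2 =
  diag2 a * companionV a ^+ k.+1 - companionV a ^+ k.
Proof.
rewrite -companionD mulrDl -exprS [companionV a ^+ k.+1]exprS mulrA companionVK mul1r.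
by rewrite addrAC subrr add0r.
Qed.

Lemma companionVX_mul a j k : companionV a ^+ j * companion a ^+ (j + k) =
  companion a ^+ k.
Proof.
elim: j => [|j IHj]; first by rewrite mul1r.
by rewrite exprSr addSn exprS -mulrA [companionV a * _]mulrA companionK mul1r.
Qed.

Lemma companionX_sub1_double a k :
  companionV a ^+ k * (companion a ^+ k.*2 - 1) =
  diag2 (chebU a k) * (companion a - companionV a).
Proof.
rewrite mulrBr mulr1 -addnn companionVX_mul diag2_chebU.
apply: (@chebU_unique _ (diag2 a) (fun k => companion a ^+ k - companionV a ^+ k)).
- by rewrite subrr.
- by rewrite !expr1.
by move=> j; rewrite companionX_rec companionVX_rec mulrBr !opprD opprK addrACA.
Qed.

Lemma companionX_sub1_doubleS a k :
  companionV a ^+ k * (companion a ^+ k.*2.+1 - 1) =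
  diag2 (chebU a k + chebU a k.+1) * (companion a - 1).
Proof.
rewrite mulrBr mulr1 -addnn -addnS companionVX_mul diag2D !diag2_chebU mulrDl.
apply/eqP; rewrite -subr_eq; apply/eqP.
(* M^(k+1) - M^-k starts at M - 1 rather than 0; subtracting u_(k+1) (M - 1) leaves a solution that
   starts 0, M - 1. *)
apply: (@chebU_unique _ (diag2 a) (fun k => companion a ^+ k.+1 - companionV a ^+ k
  - chebU (diag2 a) k.+1 * (companion a - 1))).
- by rewrite chebU1 mul1r expr1 expr0 subrr.
- rewrite chebU_rec chebU1 chebU0 mulr1 subr0 companionX_rec expr1 expr0.
  rewrite expr1 mulrBr mulr1 opprB addrC !addrA subrK.
  by rewrite -companionD addrAC addrK.
move=> j; rewrite companionX_rec companionVX_rec (chebU_rec _ j.+1).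
rewrite mulrBl [in RHS]mulrBr [in RHS]mulrBr mulrA.
have subACA (x y z t : 'M[int]_(m + m)) : x - y - (z - t) = x - z - (y - t).
  by rewrite !opprD !opprK addrACA.
by rewrite [X in X - _ = _]subACA [LHS]subACA.
Qed.

End CompanionPowers.

(** * Integer matrices with computable entries *)

Section ConcreteMatrices.
Implicit Types F G : nat -> nat -> int.

(** Entries are functions on naturals and products are folds over [iota], so that [vm_compute] can
    decide identities between concrete matrices. *)
Definition fmx m F : 'M[int]_m := \matrix_(i, j) F i j.

Definition feq m F G : bool :=
  all (fun i => all (fun j => F i j == G i j) (iota 0 m)) (iota 0 m).

Definition fmul m F G i j : int :=
  foldr (fun k s => F i k * G k j + s) 0 (iota 0 m).

Definition fblock m F1 F2 F3 F4 i j : int :=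
  if (i < m)%N then if (j < m)%N then F1 i j else F2 i (j - m)%N
  else if (j < m)%N then F3 (i - m)%N j else F4 (i - m)%N (j - m)%N.

Definition fdiag (d : seq int) (i j : nat) : int := d`_i *+ (i == j).

Definition fscal (c : int) (i j : nat) : int := c *+ (i == j).

Definition flist (l : seq (seq int)) i j : int := (nth [::] l i)`_j.

Lemma fmx_eq m F G : feq m F G -> fmx m F = fmx m G.
Proof.
move=> /allP FG; apply/matrixP => i j; rewrite !mxE; apply/eqP.
have i_iota (k : 'I_m) : (k : nat) \in iota 0 m by rewrite mem_iota ltn_ord.
by have /allP := FG _ (i_iota i); apply.
Qed.

Lemma fmx_mul m F G : fmx m F *m fmx m G = fmx m (fmul m F G).
Proof.
apply/matrixP => i j; rewrite !mxE /fmul.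
under eq_bigr do rewrite !mxE.
rewrite -(big_mkord xpredT (fun k => F i k * G k j)) /index_iota subn0.
by elim: (iota 0 m) => [|k s IHs]; rewrite ?big_nil //= big_cons IHs.
Qed.

Lemma fmx_block m F1 F2 F3 F4 :
  block_mx (fmx m F1) (fmx m F2) (fmx m F3) (fmx m F4) =
  fmx (m + m) (fblock m F1 F2 F3 F4).
Proof.
apply/matrixP => i j; rewrite [RHS]mxE /fblock -[i]splitK -[j]splitK.
case: (split i) => i'; case: (split j) => j' /=.
- by rewrite block_mxEul !mxE !ltn_ord.
- by rewrite block_mxEur !mxE ltn_ord -ltn_subRL subnn ltn0 addKn.
- by rewrite block_mxEdl !mxE ltn_ord -ltn_subRL subnn ltn0 addKn.
- by rewrite block_mxEdr !mxE -!ltn_subRL subnn !ltn0 !addKn.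
Qed.

Lemma fmx_opp m F : - fmx m F = fmx m (fun i j => - F i j).
Proof. by apply/matrixP => i j; rewrite !mxE. Qed.

Lemma fmx_sub m F G : fmx m F - fmx m G = fmx m (fun i j => F i j - G i j).
Proof. by apply/matrixP => i j; rewrite !mxE. Qed.

Lemma fmx_scal m c : c%:M = fmx m (fscal c).
Proof. by apply/matrixP => i j; rewrite !mxE. Qed.

Lemma fmx_unit m F G : feq m (fmul m F G) (fscal 1) -> fmx m F \in unitmx.
Proof.
move=> FG; have : fmx m F *m fmx m G = 1%:M by rewrite fmx_mul fmx_scal; apply: fmx_eq.
by case/mulmx1_unit.
Qed.

(** The inverses P' and Q' certify unimodularity by a product, without expanding a determinant. *)
Lemma fmx_pequiv p m (X P P' Q Q' : nat -> nat -> int) d : prime p ->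
  feq m (fmul m P X) (fmul m (fdiag d) Q) ->
  feq m (fmul m P P') (fscal 1) -> feq m (fmul m Q Q') (fscal 1) ->
  pequiv p (fmx m X) (diagz m d).
Proof.
move=> p_prime PX PP QQ; exists (fmx m P), (fmx m Q); split.
- exact: dvdz_det_unitmx (fmx_unit PP).
- exact: dvdz_det_unitmx (fmx_unit QQ).
by rewrite (_ : diagz m d = fmx m (fdiag d)) // !fmx_mul; apply: fmx_eq.
Qed.

End ConcreteMatrices.

(* Unimodular matrices witnessing the Smith normal forms below: each [X_inv] is
   the inverse of [X], and [X_left * A = D * X_right] with [D] diagonal. *)
Definition N_left : seq (seq int) :=
  [:: [:: 1; 0; 0; 0; 0; 0; 0; 0];
    [:: 4; 1; 0; 0; 0; 0; 0; 0];
    [:: 0; 0; 0; 0; 1; 0; 0; 0];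
    [:: -2; 0; 0; 0; 4; 1; 0; 0];
    [:: -4; -1; 0; 1; 2; 0; 0; 0];
    [:: 3; 0; 1; 4; -8; -2; 0; 0];
    [:: 10; 3; 2; 3; -7; 0; 1; 0];
    [:: 1; 1; 1; 1; 1; 1; 1; 1]].

Definition N_left_inv : seq (seq int) :=
  [:: [:: 1; 0; 0; 0; 0; 0; 0; 0];
    [:: -4; 1; 0; 0; 0; 0; 0; 0];
    [:: 1; -4; 8; 2; -4; 1; 0; 0];
    [:: 0; 1; -2; 0; 1; 0; 0; 0];
    [:: 0; 0; 1; 0; 0; 0; 0; 0];
    [:: 2; 0; -4; 1; 0; 0; 0; 0];
    [:: 0; 2; -3; -4; 5; -2; 1; 0];
    [:: 0; 0; 0; 1; -2; 1; -1; 1]].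

Definition N_right : seq (seq int) :=
  [:: [:: -4; 1; 0; 1; -2; 0; 0; 0];
    [:: -15; 0; 1; 4; -8; -2; 0; 0];
    [:: 2; 0; 0; 0; 4; -1; 0; -1];
    [:: 16; 0; 0; -2; 19; 0; -1; -4];
    [:: 5; 0; 0; -2; 4; 0; 0; -1];
    [:: -2; 0; 0; -1; -3; 0; 0; 0];
    [:: -1; 0; 0; 0; -1; 0; 0; 0];
    [:: 0; 0; 0; 0; 1; 0; 0; 0]].

Definition N_right_inv : seq (seq int) :=
  [:: [:: 0; 0; 0; 0; 0; 0; -1; -1];
    [:: 1; 0; 0; 0; 0; 1; -6; -1];
    [:: 0; 1; -2; 0; 2; 0; -9; -1];
    [:: 0; 0; 0; 0; 0; -1; 2; -1];
    [:: 0; 0; 0; 0; 0; 0; 0; 1];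
    [:: 0; 0; -1; 0; 1; -2; 7; 1];
    [:: 0; 0; 0; -1; 4; -6; 16; 1];
    [:: 0; 0; 0; 0; -1; 2; -9; 1]].

Definition aN_left : seq (seq int) :=
  [:: [:: 1; 0; 0; 0; 0; 0; 0; 0];
    [:: 4; 1; 0; 0; 0; 0; 0; 0];
    [:: 7; 4; 1; 0; 0; 0; 0; 0];
    [:: 14; 7; 2; 1; 0; 0; 0; 0];
    [:: -4; -2; 0; 1; 1; 0; 0; 0];
    [:: 0; 0; -1; -2; 2; 1; 0; 0];
    [:: 8; 5; 4; 5; -3; 0; 1; 0];
    [:: 1; 1; 1; 1; 1; 1; 1; 1]].

Definition aN_left_inv : seq (seq int) :=
  [:: [:: 1; 0; 0; 0; 0; 0; 0; 0];
    [:: -4; 1; 0; 0; 0; 0; 0; 0];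
    [:: 9; -4; 1; 0; 0; 0; 0; 0];
    [:: -4; 1; -2; 1; 0; 0; 0; 0];
    [:: 0; 1; 2; -1; 1; 0; 0; 0];
    [:: 1; -4; -7; 4; -2; 1; 0; 0];
    [:: -4; 9; 12; -8; 3; 0; 1; 0];
    [:: 1; -4; -6; 4; -2; -1; -1; 1]].

Definition aN_right : seq (seq int) :=
  [:: [:: -9; 4; -1; 4; -4; 1; 0; 1];
    [:: -32; 7; 0; 15; -15; 0; 1; 4];
    [:: -12; -1; 0; 7; -6; -2; 0; 2];
    [:: -8; 0; 0; 4; -4; -1; 0; 1];
    [:: 3; 0; 0; -2; 2; 0; 0; -1];
    [:: 0; 0; 0; 1; 1; 0; 0; 0];
    [:: -1; 0; 0; 0; -1; 0; 0; 0];
    [:: 0; 0; 0; 0; 1; 0; 0; 0]].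

Definition aN_right_inv : seq (seq int) :=
  [:: [:: 0; 0; 0; 0; 0; 0; -1; -1];
    [:: 0; 0; -1; 2; 0; -1; -4; -1];
    [:: -1; 0; -4; 7; -2; 0; -5; -1];
    [:: 0; 0; 0; 0; 0; 1; 0; -1];
    [:: 0; 0; 0; 0; 0; 0; 0; 1];
    [:: 0; 0; 0; -1; -1; 2; 5; 1];
    [:: 0; 1; 7; -14; 4; 0; 8; 1];
    [:: 0; 0; 0; 0; -1; -2; -3; 1]].

Definition lap_left : seq (seq int) :=
  [:: [:: 1; 0; 0; 0];
    [:: 2; 1; 0; 0];
    [:: 3; 2; 1; 0];
    [:: 1; 1; 1; 1]].

Definition lap_left_inv : seq (seq int) :=
  [:: [:: 1; 0; 0; 0];
    [:: -2; 1; 0; 0];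
    [:: 1; -2; 1; 0];
    [:: 0; 1; -1; 1]].

Definition lap_right : seq (seq int) :=
  [:: [:: 2; -1; 0; -1];
    [:: 3; 0; -1; -2];
    [:: 1; 0; 0; -1];
    [:: 0; 0; 0; 1]].

Definition lap_right_inv : seq (seq int) :=
  [:: [:: 0; 0; 1; 1];
    [:: -1; 0; 2; 1];
    [:: 0; -1; 3; 1];
    [:: 0; 0; 0; 1]].

Definition fstep (i j : nat) : int := if i == j then 4 else - (odd (i + j))%:Z.

Lemma stepC4_fmx : stepC4 = fmx 4 fstep.
Proof. by []. Qed.

Lemma zero_fmx m : 0 = fmx m (fscal 0).
Proof. by apply/matrixP => i j; rewrite !mxE /fscal mul0rn. Qed.

Definition fN : nat -> nat -> int :=
  fblock 4 (fun i j => - fstep i j) (fscal (-2)) (fscal 2) fstep.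

Lemma companionB_fmx : companion stepC4 - companionV stepC4 = fmx 8 fN.
Proof.
rewrite /companion /companionV stepC4_fmx !fmx_scal zero_fmx !fmx_opp.
by rewrite !fmx_block fmx_sub; apply: fmx_eq; vm_compute.
Qed.

Definition flap : nat -> nat -> int :=
  fblock 4 (fscal 1) (fscal 0) (fscal 0) (fun i j => fstep i j - fscal 2 i j).

Lemma block_lap_fmx : block_mx 1 0 0 (stepC4 - 2%:M) = fmx (4 + 4) flap.
Proof. by rewrite stepC4_fmx [1]fmx_scal fmx_scal zero_fmx fmx_sub fmx_block. Qed.

Definition faN : nat -> nat -> int :=
  fmul 8 (fblock 4 fstep (fscal 0) (fscal 0) fstep) fN.

Lemma diag2_companionB_fmx :
  diag2 stepC4 * (companion stepC4 - companionV stepC4) = fmx 8 faN.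
Proof.
by rewrite companionB_fmx /diag2 stepC4_fmx zero_fmx fmx_block -fmx_mul.
Qed.

Definition fext (l : seq (seq int)) : nat -> nat -> int :=
  fblock 4 (fscal 1) (fscal 0) (fscal 0) (flist l).

(** [stepC4 - 2%:M] is the Laplacian of C_4, with Smith form 1, 1, 4, 0. *)
Lemma lap_pequiv2 :
  pequiv 2 (block_mx 1 0 0 (stepC4 - 2%:M)) (diagz (4 + 4) [:: 1; 1; 1; 1; 1; 1; 4; 0]).
Proof.
rewrite block_lap_fmx.
by apply: (@fmx_pequiv 2 8 flap (fext lap_left) (fext lap_left_inv) (fext lap_right)
  (fext lap_right_inv)); vm_compute.
Qed.

(** The entries 4, 12, 48 are the constants of the case n = 2s, s odd, where s, e_s and f_s are all
    odd. *)
Lemma N_pequiv2 :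
  pequiv 2 (companion stepC4 - companionV stepC4)
    (diagz (4 + 4) [:: 1; 1; 1; 1; 4; 12; 48; 0]).
Proof.
rewrite companionB_fmx.
by apply: (@fmx_pequiv 2 8 fN (flist N_left) (flist N_left_inv) (flist N_right)
  (flist N_right_inv)); vm_compute.
Qed.

Lemma aN_pequiv2 :
  pequiv 2 (diag2 stepC4 * (companion stepC4 - companionV stepC4))
    (diagz (4 + 4) [:: 2; 2; 8; 24; 24; 24; 96; 0]).
Proof.
rewrite diag2_companionB_fmx.
by apply: (@fmx_pequiv 2 8 faN (flist aN_left) (flist aN_left_inv) (flist aN_right)
  (flist aN_right_inv)); vm_compute.
Qed.

(** * Local normal forms of the powers of the companion matrix *)

Lemma dvdz_det_scalar p m (L K : 'M[int]_m) (c : int) : prime p ->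
  ~~ (p %| c)%Z -> L *m K = c%:M -> ~~ (p %| \det L)%Z.
Proof.
move=> p_prime pc LK; have : ~~ (p %| c ^+ m)%Z.
  elim: m {L K LK} => [|m IHm]; first by rewrite dvdz_prime1.
  by rewrite exprS dvdz_primeM // negb_or pc.
by apply: contra => pL; rewrite -det_scalar -LK det_mulmx dvdz_mulr.
Qed.

Lemma companionVX_unit m (a : 'M[int]_m) k : companionV a ^+ k \in unitmx.
Proof.
suff: companionV a ^+ k *m companion a ^+ k = 1%:M by case/mulmx1_unit.
elim: k => [|k IHk]; first by rewrite mul1mx.
rewrite exprSr exprS -[_ *m _]mulrA [companionV a * _]mulrA companionK mul1r.
exact: IHk.
Qed.

(** M - 1 has rows (-1, -1) and (1, a - 1); its pivot -1 is a unit, and clearing leaves a - 2. *)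
Lemma pequiv_odd_block p m (a : 'M[int]_m) s : prime p ->
  let H := chebU a s + chebU a s.+1 in
  pequiv p (companion a ^+ s.*2.+1 - 1) (block_mx H 0 0 (H *m (a - 2%:M))).
Proof.
move=> p_prime H; apply: (@pequiv_trans _ p_prime _ (diag2 H * (companion a - 1))).
  apply: (pequiv_unit p_prime (companionVX_unit a s) (unitmx1 _ _)).
  by rewrite mulmx1 -companionX_sub1_doubleS.
pose L0 : 'M[int]_(m + m) := block_mx (- 1%:M) 0 1%:M 1%:M.
pose R0 : 'M[int]_(m + m) := block_mx 1%:M 1%:M 0 1%:M.
apply: (@pequiv_unit _ p_prime _ L0 R0).
- by rewrite unitmxE det_lblock det1 mulr1 -scaleN1r detZ det1 mulr1 unitrX.
- by rewrite unitmxE det_ublock !det1.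
rewrite block1 opp_block_mx add_block_mx -mulmxE !mulmx_block.
rewrite !mulmx0 !mul0mx !mulmx1 !mul1mx !oppr0 !addr0 !add0r !mulmxN !mulmx1 !mulNmx !mul1mx.
rewrite opprK addNr; congr block_mx.
have -> : 2%:M = 1%:M + 1%:M :> 'M[int]_m by rewrite -raddfD.
transitivity (H *m (a - 1%:M) - H *m 1%:M); first by rewrite mulmx1 addrC.
by rewrite -mulmxBr -addrA -opprD.
Qed.

Lemma pequiv_even p m (a : 'M[int]_m) s : prime p ->
  pequiv p (companion a ^+ s.*2 - 1)
    (diag2 (chebU a s) * (companion a - companionV a)).
Proof.
move=> p_prime; apply: (pequiv_unit p_prime (companionVX_unit a s) (unitmx1 _ _)).
by rewrite mulmx1 -companionX_sub1_double.
Qed.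

(** M - M^-1 has rows (-a, -2) and (2, a); 2 serves as pivot because p is odd, and clearing leaves
    a^2 - 4. *)
Lemma pequiv_even_block p m (a : 'M[int]_m) s : prime p -> ~~ (p %| 2)%N ->
  let U := chebU a s in
  pequiv p (companion a ^+ s.*2 - 1) (block_mx U 0 0 (U *m (a *m a - 4%:M))).
Proof.
move=> p_prime p_odd U; apply: (pequiv_trans p_prime (pequiv_even a s p_prime)).
have Ua : a *m U = U *m a by apply/chebU_comm/commr_refl.
pose L0 : 'M[int]_(m + m) := block_mx 0 1%:M 2%:M a.
pose R0 : 'M[int]_(m + m) := block_mx 2%:M a 0 1%:M.
have two_block : 2%:M = block_mx 2%:M 0 0 2%:M :> 'M[int]_(m + m).
  exact: scalar_mx_block.
exists L0, R0; split.
- apply: (@dvdz_det_scalar _ _ _ (block_mx (- a) 1%:M 2%:M 0) 2) => //.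
  rewrite mulmx_block two_block !mulmx0 !mul0mx !mulmx1 !mul1mx !add0r !addr0.
  by rewrite mulmxN scalar_mxC addNr.
- apply: (@dvdz_det_scalar _ _ _ (block_mx 1%:M (- a) 0 2%:M) 2) => //.
  rewrite mulmx_block two_block !mulmx0 !mul0mx !mulmx1 !mul1mx !add0r !addr0.
  by rewrite mulmxN scalar_mxC addNr.
rewrite /companion /companionV opp_block_mx add_block_mx.
rewrite -mulmxE !mulmx_block !mulmx0 !mul0mx !mul1mx !addr0 !add0r.
have two : 1%:M + 1%:M = 2%:M :> 'M[int]_m by rewrite -raddfD.
rewrite opprK two subr0 -opprD two !mulmxN !(mulmxA a) -/U Ua; congr block_mx.
  by rewrite -scalar_mxC addNr.
rewrite mulmx1 mulmxBr mulmxA addrC; congr (_ - _).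
  by rewrite mulmxA.
by rewrite -scalar_mxC -mulmxA -scalar_mxM.
Qed.

Lemma pequiv_block_intertwine p m (E E' X Y X' Y' : 'M[int]_m) c : prime p ->
  ~~ (p %| c)%Z -> E *m E' = c%:M -> E *m X = X' *m E -> E *m Y = Y' *m E ->
  pequiv p (block_mx X 0 0 Y) (block_mx X' 0 0 Y').
Proof.
move=> p_prime pc EE EX EY.
have pE : ~~ (p %| \det (diag2 E))%Z.
  apply: (@dvdz_det_scalar _ _ _ (diag2 E') c) => //.
  by rewrite mulmxE -diag2M EE /diag2 -scalar_mx_block.
exists (diag2 E), (diag2 E); split=> //.
by rewrite !mulmx_block !mulmx0 !mul0mx !addr0 !add0r EX EY.
Qed.

Lemma diagz_mulE m d (M : 'M[int]_m) i j : (diagz m d *m M) i j = d`_i * M i j.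
Proof.
rewrite mxE (bigD1 i) //= !mxE eqxx mulr1n big1 ?addr0 // => k.
by rewrite !mxE val_eqE eq_sym => /negPf ->; rewrite mulr0n mul0r.
Qed.

Lemma diagz_block m d1 d2 : size d1 = m ->
  block_mx (diagz m d1) 0 0 (diagz m d2) = diagz (m + m) (d1 ++ d2).
Proof.
move=> sz; apply/matrixP => i j; rewrite [RHS]mxE nth_cat sz -[i]splitK -[j]splitK.
case: (split i) => i'; case: (split j) => j' /=.
- by rewrite block_mxEul !mxE !ltn_ord.
- rewrite block_mxEur !mxE ltn_ord [_ == _](_ : _ = false) ?mulr0n //.
  by apply/negP => /eqP e; have := ltn_ord i'; rewrite e -ltn_subRL subnn ltn0.
- rewrite block_mxEdl !mxE [_ == _](_ : _ = false) ?mulr0n //.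
  by apply/negP => /eqP e; have := ltn_ord j'; rewrite -e -ltn_subRL subnn ltn0.
- by rewrite block_mxEdr !mxE -!ltn_subRL subnn !ltn0 !addKn eqn_add2l.
Qed.

Lemma chebU_diagz m (d : seq int) k : size d = m ->
  chebU (diagz m d) k = diagz m [seq chebU x k | x <- d].
Proof.
move=> sz; rewrite -[LHS]mulr1; apply/esym.
have entry i j k' : diagz m [seq chebU x k' | x <- d] i j = chebU d`_i k' *+ (i == j).
  by rewrite mxE (nth_map 0) ?sz.
apply: (@chebU_unique _ (diagz m d) (fun k => diagz m [seq chebU x k | x <- d]) 1) => [||k'].
- by apply/matrixP => i j; rewrite entry chebU0 mul0rn mxE.
- by apply/matrixP => i j; rewrite entry chebU1 mxE.
apply/matrixP => i j; rewrite entry chebU_rec mulrnBl mxE [X in _ = X + _]diagz_mulE.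
by rewrite [X in _ = _ + X]mxE !entry mulrnAr.
Qed.

(* Rows: evaluation of a function on [C_4] at the characters [1] and [-1], and
   the real and imaginary parts of the evaluation at [i]. *)
Definition charC4 : 'M[int]_4 := fmx 4 (flist
  [:: [:: 1; 1; 1; 1]; [:: 1; -1; 1; -1]; [:: 1; 0; -1; 0]; [:: 0; 1; 0; -1]]).

Definition charC4_inv : 'M[int]_4 := fmx 4 (flist
  [:: [:: 1; 1; 2; 0]; [:: 1; -1; 0; 2]; [:: 1; 1; -2; 0]; [:: 1; -1; 0; -2]]).

Lemma charC4K : charC4 *m charC4_inv = 4%:M.
Proof. by rewrite fmx_mul fmx_scal; apply: fmx_eq; vm_compute. Qed.

(** Values of 4 - t - t^-1 at t = 1, -1 and twice at i, in the order of the rows of [charC4]. *)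
Definition eigC4 : seq int := [:: 2; 6; 4; 4].

Lemma charC4_step : charC4 *m stepC4 = diagz 4 eigC4 *m charC4.
Proof.
by rewrite stepC4_fmx (_ : diagz 4 _ = fmx 4 (fdiag eigC4)) // !fmx_mul;
  apply: fmx_eq; vm_compute.
Qed.

Lemma charC4_chebU k :
  charC4 *m chebU stepC4 k = diagz 4 [seq chebU x k | x <- eigC4] *m charC4.
Proof. by rewrite -chebU_diagz //; apply: chebU_intertwine charC4_step. Qed.

Lemma diagzD m d d' : size d = m -> size d' = m ->
  diagz m d + diagz m d' = diagz m [seq x.1 + x.2 | x <- zip d d'].
Proof.
move=> sz sz'; apply/matrixP => i j; rewrite !mxE -mulrnDl (nth_map (0, 0)).
  by rewrite nth_zip ?sz.
by rewrite size_zip sz sz' minnn.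
Qed.

Lemma diagzM m d d' : size d = m -> size d' = m ->
  diagz m d *m diagz m d' = diagz m [seq x.1 * x.2 | x <- zip d d'].
Proof.
move=> sz sz'; apply/matrixP => i j; rewrite diagz_mulE !mxE mulrnAr (nth_map (0, 0)).
  by rewrite nth_zip ?sz.
by rewrite size_zip sz sz' minnn.
Qed.

Lemma diagz_scalar m c : c%:M = diagz m (nseq m c).
Proof. by apply/matrixP => i j; rewrite !mxE nth_nseq ltn_ord. Qed.

Lemma diagzN m d : size d = m -> - diagz m d = diagz m [seq - x | x <- d].
Proof.
by move=> sz; apply/matrixP => i j; rewrite !mxE -mulNrn (nth_map 0) ?sz.
Qed.

Lemma charC4_doubleS s :
  charC4 *m (chebU stepC4 s + chebU stepC4 s.+1) =
  diagz 4 [:: s.*2.+1%:Z; (g_ s)%:Z; (h_ s)%:Z; (h_ s)%:Z] *m charC4.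
Proof.
rewrite mulmxDr !charC4_chebU -mulmxDl diagzD //= -h_chebU -g_chebU !chebU_2.
by congr (diagz _ (_ :: _) *m _); lia.
Qed.

Lemma charC4_U s :
  charC4 *m chebU stepC4 s =
  diagz 4 [:: s%:Z; (f_ s)%:Z; (e_ s)%:Z; (e_ s)%:Z] *m charC4.
Proof. by rewrite charC4_chebU /= -e_chebU -f_chebU chebU_2. Qed.

(** [charC4] is invertible over Q, so the determinant can be read off the eigenvalues even at p = 2,
    where conjugation by [charC4] is not integral. *)
Lemma charC4_det (X : 'M[int]_4) (d : seq int) : size d = 4 ->
  charC4 *m X = diagz 4 d *m charC4 -> \det X = \prod_(x <- d) x.
Proof.
move=> sz /(congr1 determinant); rewrite !det_mulmx.
have -> : diagz 4 d = diag_mx (\row_j d`_j) by apply/matrixP => i j; rewrite !mxE val_eqE.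
have : \det charC4 != 0.
  have := congr1 determinant charC4K; rewrite det_mulmx det_scalar.
  by apply: contra_eqN => /eqP ->; rewrite mul0r.
rewrite mulrC => E0 /(mulIf E0) ->; rewrite det_diag [RHS](big_nth 0) sz big_mkord.
by apply: eq_bigr => i _; rewrite mxE.
Qed.

Lemma ndvdz4 p : prime p -> ~~ (p %| 2)%N -> ~~ (p %| 4)%Z.
Proof.
by move=> p_prime p_odd; rewrite dvdzE (_ : `|4| = 2 * 2)%N // Euclid_dvdM // orbb.
Qed.

Lemma pequiv_p_doubleS p s : prime p -> ~~ (p %| 2)%N ->
  pequiv p (companion stepC4 ^+ s.*2.+1 - 1)
    (diagz (4 + 4) [:: s.*2.+1%:Z; (g_ s)%:Z; (h_ s)%:Z; (h_ s)%:Z;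
                 0; 4 * (g_ s)%:Z; 2 * (h_ s)%:Z; 2 * (h_ s)%:Z]).
Proof.
move=> p_prime p_odd.
apply: (pequiv_trans p_prime (pequiv_odd_block _ _ p_prime)).
rewrite -(@diagz_block 4 [:: _; _; _; _]) //.
apply: (@pequiv_block_intertwine _ _ charC4 charC4_inv _ _ _ _ 4 p_prime _ charC4K).
- exact: ndvdz4.
- exact: charC4_doubleS.
rewrite mulmxA charC4_doubleS -!mulmxA mulmxBr charC4_step mul_mx_scalar -mul_scalar_mx.
rewrite -mulmxBl !mulmxA diagz_scalar diagzN // diagzD // diagzM //=.
congr (diagz _ _ *m _); congr [:: _; _; _; _]; ring.
Qed.

Lemma pequiv_p_double p s : prime p -> ~~ (p %| 2)%N ->
  pequiv p (companion stepC4 ^+ s.*2 - 1)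
    (diagz (4 + 4) [:: s%:Z; (f_ s)%:Z; (e_ s)%:Z; (e_ s)%:Z;
                 0; 32 * (f_ s)%:Z; 12 * (e_ s)%:Z; 12 * (e_ s)%:Z]).
Proof.
move=> p_prime p_odd.
apply: (pequiv_trans p_prime (pequiv_even_block _ _ p_prime p_odd)).
rewrite -(@diagz_block 4 [:: _; _; _; _]) //.
apply: (@pequiv_block_intertwine _ _ charC4 charC4_inv _ _ _ _ 4 p_prime _ charC4K).
- exact: ndvdz4.
- exact: charC4_U.
rewrite mulmxA charC4_U -!mulmxA mulmxBr mulmxA charC4_step -mulmxA charC4_step.
rewrite mul_mx_scalar -mul_scalar_mx.
rewrite !mulmxA -mulmxBl !mulmxA diagz_scalar diagzM // diagzN // diagzD // diagzM //=.
congr (diagz _ _ *m _); congr [:: _; _; _; _]; ring.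
Qed.

Lemma pequiv_mulr_sym p m (X A : 'M[int]_m) : prime p ->
  ~~ (p %| \det X)%Z -> pequiv p (X *m A) A.
Proof.
move=> p_prime pX; apply: pequiv_sym => //; exists X, 1%:M.
by rewrite pX det1 dvdz_prime1 // mulmx1.
Qed.

Lemma ndvdz_det_diag2 p m (X : 'M[int]_m) : prime p ->
  ~~ (p %| \det X)%Z -> ~~ (p %| \det (diag2 X))%Z.
Proof. by move=> p_prime pX; rewrite det_lblock dvdz_primeM // orbb. Qed.

Lemma ndvdz2_nat n : ~~ (2 %| n%:Z)%Z = odd n.
Proof. by rewrite dvdzE dvdn2 negbK. Qed.

Lemma h_odd s : odd (h_ s).
Proof. by rewrite /h_ oddD !uN_odd //=; case: odd. Qed.

Lemma g_odd s : odd (g_ s).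
Proof. by rewrite /g_ oddD !uN_odd //=; case: odd. Qed.

(** The scalar [H] has determinant n g_s h_s^2 with n = 2s + 1, which is odd; it drops out at 2 and
    leaves the Laplacian of C_4. *)
Lemma pequiv2_doubleS s :
  pequiv 2 (companion stepC4 ^+ s.*2.+1 - 1)
    (diagz (4 + 4) [:: 1; 1; 1; 1; 1; 1; 4; 0]).
Proof.
apply: (pequiv_trans _ (pequiv_odd_block _ _ _)) => //.
set H := chebU _ s + _; apply: (pequiv_trans _ _ lap_pequiv2) => //.
have -> : block_mx H 0 0 (H *m (stepC4 - 2%:M)) = diag2 H *m block_mx 1 0 0 (stepC4 - 2%:M).
  by rewrite mulmx_block !mulmx0 !mul0mx mulmx1 !addr0 !add0r.
apply: pequiv_mulr_sym => //; apply: ndvdz_det_diag2 => //.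
rewrite (charC4_det _ (charC4_doubleS s)) // !big_cons big_nil.
by rewrite !dvdz_primeM // !negb_or !ndvdz2_nat h_odd g_odd /= odd_double.
Qed.

Lemma pequiv2_double_odd s : odd s ->
  pequiv 2 (companion stepC4 ^+ s.*2 - 1)
    (diagz (4 + 4) [:: 1; 1; 1; 1; 4; 12; 48; 0]).
Proof.
move=> s_odd; apply: (pequiv_trans _ (pequiv_even _ _ _)) => //.
apply: (pequiv_trans _ _ N_pequiv2) => //.
apply: pequiv_mulr_sym => //; apply: ndvdz_det_diag2 => //.
rewrite (charC4_det _ (charC4_U s)) // !big_cons big_nil.
by rewrite !dvdz_primeM // !negb_or !ndvdz2_nat !uN_odd // s_odd.
Qed.

(** Modulo p the matrix is the identity. *)
Lemma ndvdz_det_1Dp p m (q : 'M[int]_m) : prime p ->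
  ~~ (p %| \det (1 + p%:R * q))%Z.
Proof.
move=> p_prime; apply/negP => /dvdzP[c].
move/(congr1 (intr : int -> 'F_p)); rewrite -det_map_mx map_mxD map_mx1.
rewrite intrM -pmulrn pchar_Fp_0 // mulr0.
have -> : map_mx intr (p%:R * q) = 0 :> 'M['F_p]_m.
  by apply/matrixP => i j; rewrite mulr_natl 2!mxE mulmxnE raddfMn /= -mulr_natl pchar_Fp_0 // mul0r.
by rewrite addr0 det1 => /eqP; rewrite oner_eq0.
Qed.

Definition step2C4 : 'M[int]_4 :=
  fmx 4 (fun i j => if i == j then 8 else if odd (i + j) then -4 else 1).

Lemma step2C4E : stepC4 ^+ 2 - 2 = 2 * step2C4.
Proof.
have two : 2 = fmx 4 (fscal 2) by rewrite -fmx_scal raddfMn.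
rewrite expr2 -!mulmxE stepC4_fmx two !fmx_mul fmx_sub.
by apply: fmx_eq; vm_compute.
Qed.

Lemma step2C4_det : ~~ (2 %| \det step2C4)%Z.
Proof.
(* The eigenvalues (b^2 - 2)/2 of [step2C4] for b = 2, 4, 6 are 1, 7, 17, and 119 = 7 * 17; [inv119]
   is 119 times the inverse. *)
pose inv119 : 'M[int]_4 :=
  fmx 4 (fun i j => if i == j then 40 else if odd (i + j) then 28 else 23).
apply: (@dvdz_det_scalar 2 4 _ inv119 119) => //.
by rewrite fmx_mul fmx_scal; apply: fmx_eq; vm_compute.
Qed.

Lemma pequiv_mulrn p m (A B : 'M[int]_m) c : pequiv p A B -> pequiv p (A *+ c) (B *+ c).
Proof.
move=> [P [Q [pP pQ PQ]]]; exists P, Q; split => //.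
by rewrite -!scaler_nat -scalemxAr PQ scalemxAl.
Qed.

(** Doubling gives u_(2k) = a U_k(a^2 - 2), and a^2 - 2 = 2 [step2C4] with [step2C4] of odd
    determinant; hence u_(2k) is 2^(v_2(k)) a times a matrix invertible at 2. *)
Lemma pequiv2_double_even k : (0 < k)%N ->
  pequiv 2 (companion stepC4 ^+ k.*2.*2 - 1)
    (diagz (4 + 4) [seq x *+ 2 ^ logn 2 k | x <- [:: 2; 2; 8; 24; 24; 24; 96; 0]]).
Proof.
move=> k_gt0; apply: (pequiv_trans _ (pequiv_even _ _ _)) => //.
have [||x x_odd ex] := @chebU_2adic 'M[int]_4 (fun x => ~~ (2 %| \det x)%Z) _ _
    k step2C4 k_gt0 step2C4_det.
- by move=> x y; rewrite det_mulmx dvdz_primeM // negb_or => -> ->.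
- by move=> q; apply: ndvdz_det_1Dp.
have -> : chebU stepC4 k.*2 = (x *m stepC4) *+ 2 ^ logn 2 k.
  rewrite chebU_double (_ : stepC4 * _ = chebU (stepC4 ^+ 2 - 2) k * stepC4).
    by rewrite step2C4E ex -natrX mulr_natl mulrnAl.
  by apply/chebU_comm/commrB; [apply/commrX/commr_refl | apply: commr_nat].
have -> : diag2 ((x *m stepC4) *+ 2 ^ logn 2 k) = (diag2 x * diag2 stepC4) *+ 2 ^ logn 2 k.
  rewrite -diag2M; elim: (2 ^ _)%N => [|n IHn]; first by rewrite /diag2 block_mx0.
  by rewrite !mulrS diag2D IHn.
rewrite mulrnAl -mulrA -mulrnAr; apply: (@pequiv_trans _ _ _
  ((diag2 stepC4 * (companion stepC4 - companionV stepC4)) *+ 2 ^ logn 2 k)) => //.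
  by apply: pequiv_mulr_sym => //; apply: ndvdz_det_diag2.
have -> : diagz (4 + 4) [seq x0 *+ 2 ^ logn 2 k | x0 <- [:: 2; 2; 8; 24; 24; 24; 96; 0]] =
   diagz (4 + 4) [:: 2; 2; 8; 24; 24; 24; 96; 0] *+ 2 ^ logn 2 k.
  apply/matrixP => i j; rewrite mulmxnE !mxE (nth_map 0) ?ltn_ord //.
  by rewrite mulrnAC.
exact/pequiv_mulrn/aN_pequiv2.
Qed.

(** * Comparison of valuations *)

(* The valuation shifted by one, so that [0] can be given the value [0]. *)
Definition zval (p : nat) (x : int) : nat :=
  if x == 0 then 0%N else (logn p `|x|).+1.

Lemma zval_eq p x y : prime p -> zval p x = zval p y ->
  exists u : int * int, [/\ ~~ (p %| u.1)%Z, ~~ (p %| u.2)%Z & u.1 * x = y * u.2].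
Proof.
move=> p_prime; rewrite /zval.
have [->|x0] := eqVneq x 0; have [->|y0] := eqVneq y 0 => //.
  by exists (1, 1); rewrite /= dvdz_prime1.
have split_p (z : int) : z != 0 -> exists2 u, ~~ (p %| u)%Z & z = p%:Z ^+ logn p `|z| * u.
  move=> z0; have z_gt0 : (0 < `|z|)%N by rewrite absz_gt0.
  have /dvdzP[u ez] : (p%:Z ^+ logn p `|z| %| z)%Z.
    by rewrite dvdzE abszX pfactor_dvdnn.
  exists u; last by rewrite mulrC.
  apply/negP => pu; have : (p ^ (logn p `|z|).+1 %| `|z|)%N.
    rewrite {2}ez abszM abszX expnS; apply: dvdn_mul => //.
  by rewrite pfactor_dvdn // ltnn.
have [u pu eu] := split_p x x0; have [w pw ew] := split_p y y0.
case=> e; exists (w, u); split=> //=.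
by rewrite [x in LHS]eu [y in RHS]ew e mulrCA mulrA.
Qed.

(** A permutation matching the valuations becomes a monomial matrix, its entries being the factors
    prime to p from [zval_eq]. *)
Lemma pequiv_diagz_perm p m (d d' : seq int) : prime p ->
  size d = m -> size d' = m ->
  perm_eq [seq zval p x | x <- d] [seq zval p x | x <- d'] ->
  pequiv p (diagz m d) (diagz m d').
Proof.
move=> p_prime sz sz'.
have szt : size [seq zval p x | x <- d'] == m by rewrite size_map sz'.
case/(@tuple_permP _ _ _ (Tuple szt)) => s es.
have val_s (i : 'I_m) : zval p d`_i = zval p d'`_(s i).
  rewrite -(nth_map 0 0%N) ?sz // es -tnth_nth tnth_mktuple (tnth_nth 0%N) /=.
  by rewrite (nth_map 0) ?sz'.
have [u uP] := choice (fun i => zval_eq p_prime (val_s i)).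
have detP (w : 'I_m -> int) : (forall i, ~~ (p %| w i)%Z) ->
    ~~ (p %| \det (\matrix_(j, i) (w i *+ (j == s i))))%Z.
  move=> pw; have -> : \matrix_(j, i) (w i *+ (j == s i)) =
      perm_mx s^-1%g *m diag_mx (\row_i w i).
    apply/matrixP => j i; rewrite -row_permE !mxE.
    have [->|js] := eqVneq j (s i); first by rewrite permK eqxx.
    rewrite [_ == i](_ : _ = false) //.
    by apply: contra_neqF js => /eqP <-; rewrite permKV.
  rewrite det_mulmx det_perm det_diag dvdz_primeM // negb_or; apply/andP; split.
    by have := dvdz_prime1 p_prime; rewrite !dvdzE abszX exp1n => ->.
  elim/big_ind: _ => [|x y px py|i _]; first by rewrite dvdz_prime1.
    by rewrite dvdz_primeM // negb_or px.
  by rewrite mxE.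
exists (\matrix_(j, i) ((u i).1 *+ (j == s i))), (\matrix_(j, i) ((u i).2 *+ (j == s i))).
split; [by apply: detP => i; have [] := uP i | by apply: detP => i; have [] := uP i|].
apply/matrixP => j i; rewrite diagz_mulE mxE (bigD1 i) //= !mxE eqxx mulr1n.
rewrite big1 ?addr0 => [|k]; last first.
  by rewrite !mxE val_eqE => /negPf ->; rewrite mulr0n mulr0.
have [->|_] := eqVneq j (s i); last by rewrite !mulr0n mul0r mulr0.
by rewrite !mulr1n; have [] := uP i.
Qed.

Section InvariantFactors.
Variables (c3 c4 c5 c6 c7 n h g : nat).

(** Common shape of the three cases: [n] is the order n or its half s, [h] and [g] are h_s, g_s or
    e_s, f_s, and c3, ..., c7 are the numerical constants of the last five summands. *)
Definition torus_factors : seq nat :=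
  let M := gcd3 (n * h) (n * g) (h * g) in
  [:: gcd3 n h g; gcdn h g; c3 * gcdn n h * gcdn h g %/ gcd3 n h g; c4 * h;
      c5 * h * M %/ (gcdn n h * gcdn h g); c6 * h * g %/ gcdn h g;
      c7 * n * h * g %/ M]%N.

Hypotheses (n_gt0 : (0 < n)%N) (h_gt0 : (0 < h)%N) (g_gt0 : (0 < g)%N).
Hypotheses (c_gt0 : all (leq 1) [:: c3; c4; c5; c6; c7]).

Let nh_gt0 : (0 < gcdn n h)%N. Proof. by rewrite gcdn_gt0 n_gt0. Qed.
Let hg_gt0 : (0 < gcdn h g)%N. Proof. by rewrite gcdn_gt0 h_gt0. Qed.
Let nhg_gt0 : (0 < gcd3 n h g)%N. Proof. by rewrite gcdn_gt0 nh_gt0. Qed.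
Let M_gt0 : (0 < gcd3 (n * h) (n * g) (h * g))%N.
Proof. by rewrite !gcdn_gt0 muln_gt0 n_gt0 h_gt0. Qed.

(** This and the next three facts make the truncated quotients exact, so that their valuations are
    differences. *)
Let dvd3 : (gcd3 n h g %| c3 * gcdn n h * gcdn h g)%N.
Proof. by rewrite -mulnA dvdn_mull // dvdn_mulr // dvdn_gcdl. Qed.

Let dvd5 : (gcdn n h * gcdn h g %| c5 * h * gcd3 (n * h) (n * g) (h * g))%N.
Proof.
rewrite -mulnA dvdn_mull // /gcd3 !(muln_gcdr h) !dvdn_gcd; apply/andP; split.
  apply/andP; split.
    by rewrite mulnCA dvdn_mul ?dvdn_gcdl // dvdn_mulr ?dvdn_gcdl.
  by rewrite mulnCA dvdn_mul ?dvdn_gcdl // dvdn_mulr ?dvdn_gcdl.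
by rewrite dvdn_mul ?dvdn_gcdr // dvdn_mulr ?dvdn_gcdl.
Qed.

Let dvd6 : (gcdn h g %| c6 * h * g)%N.
Proof. by rewrite dvdn_mull ?dvdn_gcdr. Qed.

Let dvd7 : (gcd3 (n * h) (n * g) (h * g) %| c7 * n * h * g)%N.
Proof. by rewrite -mulnA dvdn_mull ?dvdn_gcdr. Qed.

Lemma torus_factors_gt0 : all (leq 1) torus_factors.
Proof.
case/and5P: c_gt0 => c3_gt0 c4_gt0 c5_gt0 c6_gt0 /andP[c7_gt0 _].
have quot_gt0 a b : (b %| a -> 0 < a -> 0 < a %/ b)%N.
  by move=> ba a_gt0; rewrite divn_gt0 ?(dvdn_gt0 a_gt0 ba) // dvdn_leq.
rewrite /= nhg_gt0 hg_gt0 (quot_gt0 _ _ dvd3) ?(quot_gt0 _ _ dvd5) ?(quot_gt0 _ _ dvd6)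
  ?(quot_gt0 _ _ dvd7) //= !muln_gt0;
  by rewrite ?(c3_gt0, c4_gt0, c5_gt0, c6_gt0, c7_gt0, n_gt0, h_gt0, g_gt0, nh_gt0, hg_gt0, M_gt0).
Qed.

Lemma logn_torus_factors p :
  let x := logn p n in let y := logn p h in let z := logn p g in
  let m3 := minn (minn x y) z in
  let m2 := minn (minn (x + y) (x + z)) (y + z) in
  [seq logn p k | k <- torus_factors] =
  [:: m3; minn y z; logn p c3 + minn x y + minn y z - m3; logn p c4 + y;
      logn p c5 + y + m2 - (minn x y + minn y z);
      logn p c6 + y + z - minn y z; logn p c7 + x + y + z - m2]%N.
Proof.
case/and5P: c_gt0 => c3_gt0 c4_gt0 c5_gt0 c6_gt0 /andP[c7_gt0 _].
by rewrite /= !logn_div // /gcd3 !(lognM, logn_gcd, gcdn_gt0, muln_gt0)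
  ?(n_gt0, h_gt0, g_gt0, nh_gt0, c3_gt0, c4_gt0, c5_gt0, c6_gt0, c7_gt0).
Qed.

End InvariantFactors.

Section Valuations.
Local Open Scope nat_scope.

Ltac eval_to v := match goal with |- context [subn ?a ?b] =>
  rewrite (_ : subn a b = v); last lia end.

(** Here x, y, z are the valuations of [n], [h], [g] in [torus_factors], and t is that of 3, or 0
    when n is odd. For t > 0 the two largest entries of the second list are t + y, so 3 belongs to
    the last two summands. *)
Lemma perm_valuations_odd x y z t : t = 0 \/ z = 0 /\ x <= y ->
  perm_eq [:: x.+1; z.+1; y.+1; y.+1; 0; z.+1; (t + y).+1; (t + y).+1]
   [:: (minn (minn x y) z).+1; (minn y z).+1;
       (minn x y + minn y z - minn (minn x y) z).+1; y.+1;
       (y + minn (minn (x + y) (x + z)) (y + z) - (minn x y + minn y z)).+1;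
       (t + y + z - minn y z).+1;
       (t + x + y + z - minn (minn (x + y) (x + z)) (y + z)).+1; 0].
Proof.
case=> [->|[-> xy]]; last first.
  rewrite !minn0 (minn_idPl xy); repeat first [eval_to x | eval_to y | eval_to (t + y)].
  by apply/seq.permP => a /=; ring.
(have [xy|yx] := leqP x y; have [yz|zy] := leqP y z; have [xz|zx] := leqP x z;
  try (exfalso; lia));
  repeat first [eval_to x | eval_to y | eval_to z];
  by rewrite ?add0n; apply/seq.permP => a /=; ring.
Qed.

(** When x <= y < z the valuation z outgrows y, so the factor 3 must accompany the two middle
    entries, the fourth and fifth summands. *)
Lemma perm_valuations_even x y z t : t = 0 \/ x <= y < z ->
  perm_eq [:: x.+1; z.+1; y.+1; y.+1; 0; z.+1; (t + y).+1; (t + y).+1]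
   [:: (minn (minn x y) z).+1; (minn y z).+1;
       (minn x y + minn y z - minn (minn x y) z).+1; (t + y).+1;
       (t + y + minn (minn (x + y) (x + z)) (y + z) - (minn x y + minn y z)).+1;
       (y + z - minn y z).+1;
       (x + y + z - minn (minn (x + y) (x + z)) (y + z)).+1; 0].
Proof.
case=> [->|xyz];
  (have [xy|yx] := leqP x y; have [yz|zy] := leqP y z; have [xz|zx] := leqP x z;
  try (exfalso; lia));
  repeat first [eval_to x | eval_to y | eval_to z | eval_to 0 | eval_to (t + y)];
  rewrite ?add0n; apply/seq.permP => a /=; ring.
Qed.

End Valuations.

Definition nval (p k : nat) : nat := if k == 0%N then 0%N else (logn p k).+1.

Lemma nval_gt0 p k : (0 < k)%N -> nval p k = (logn p k).+1.
Proof. by case: k. Qed.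

Lemma nval0 p : nval p 0 = 0%N.
Proof. by []. Qed.

Lemma nvalM p c k : (0 < c)%N -> (0 < k)%N -> nval p (c * k) = (logn p c + logn p k).+1.
Proof. by move=> c0 k0; rewrite nval_gt0 ?muln_gt0 ?c0 // lognM. Qed.

(** The appended 0 stands for the zero diagonal entry, that is the free summand Z that torsion
    discards. *)
Lemma critical_group_torus_factors N c3 c4 c5 c6 c7 n h g :
  (0 < N)%N -> (0 < n)%N -> (0 < h)%N -> (0 < g)%N ->
  all (leq 1) [:: c3; c4; c5; c6; c7] ->
  let d := torus_factors c3 c4 c5 c6 c7 n h g in
  (forall p, prime p -> exists l : seq nat,
    [/\ size l = 8, pequiv p (companion stepC4 ^+ N.+1 - 1) (diagz 8 [seq k%:Z | k <- l])
      & perm_eq [seq nval p k | k <- l] (rcons [seq v.+1 | v <- [seq logn p k | k <- d]] 0)%N]) ->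
  critical_group (cart_prod (cycle_graph 4) (cycle_graph N.+1)) \simeq
    Zmod (nth 0 d 0) \oplus Zmod (nth 0 d 1) \oplus Zmod (nth 0 d 2) \oplus Zmod (nth 0 d 3) \oplus Zmod (nth 0 d 4)
      \oplus Zmod (nth 0 d 5) \oplus Zmod (nth 0 d 6).
Proof.
move=> N_gt0 n_gt0 h_gt0 g_gt0 c_gt0 d local.
have d_gt0 : all (leq 1) d by apply: torus_factors_gt0.
apply: critical_group_torus => // p p_prime.
have [l [sz Al perm]] := local p p_prime.
apply: (pequiv_trans p_prime Al).
have -> : [:: (nth 0%N d 0)%:Z; (nth 0%N d 1)%:Z; (nth 0%N d 2)%:Z; (nth 0%N d 3)%:Z; (nth 0%N d 4)%:Z; (nth 0%N d 5)%:Z; (nth 0%N d 6)%:Z; 0] =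
    [seq k%:Z | k <- rcons d 0%N] by [].
apply: pequiv_diagz_perm; rewrite ?size_map //.
have zvalE k : zval p k%:Z = nval p k by [].
rewrite -!map_comp in perm *; rewrite !(eq_map zvalE) map_rcons.
rewrite (_ : [seq nval p k | k <- d] = map (succn \o logn p) d) //.
by apply/eq_in_map => k /(allP d_gt0)/nval_gt0.
Qed.

(** * The three cases of the theorem *)

Lemma logn2_odd k : odd k -> logn 2 k = 0%N.
Proof. by move=> k_odd; rewrite lognE dvdn2 k_odd andbF. Qed.

Lemma ndvd2_prime p : prime p -> p != 2 -> ~~ (p %| 2)%N.
Proof. by move=> p_prime; rewrite dvdn_prime2. Qed.

Lemma logn_ndvd2 p e : ~~ (p %| 2)%N -> logn p (2 ^ e) = 0%N.
Proof. by move=> p_odd; rewrite lognX lognE (negPf p_odd) !andbF muln0. Qed.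

Lemma critical_group_C4_odd s : (0 < s)%N ->
  let d := torus_factors 1 1 1 1 4 s.*2.+1 (h_ s) (g_ s) in
  critical_group (cart_prod (cycle_graph 4) (cycle_graph s.*2.+1)) \simeq
    Zmod (nth 0 d 0) \oplus Zmod (nth 0 d 1) \oplus Zmod (nth 0 d 2) \oplus Zmod (nth 0 d 3) \oplus Zmod (nth 0 d 4)
      \oplus Zmod (nth 0 d 5) \oplus Zmod (nth 0 d 6).
Proof.
move=> s_gt0.
have h_gt0 : (0 < h_ s)%N by rewrite addn_gt0 uN_gt0 ?orbT.
have g_gt0 : (0 < g_ s)%N by rewrite addn_gt0 uN_gt0 ?orbT.
apply: critical_group_torus_factors; rewrite ?double_gt0 // => p p_prime.
rewrite logn_torus_factors //.
have [->|p2] := eqVneq p 2.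
  exists [:: 1; 1; 1; 1; 1; 1; 4; 0]%N; split=> //; first exact: pequiv2_doubleS.
  have s_odd : odd s.*2.+1 by rewrite /= odd_double.
  by rewrite (logn2_odd s_odd) (logn2_odd (h_odd s)) (logn2_odd (g_odd s)); vm_compute.
have p_odd := ndvd2_prime p_prime p2.
exists [:: s.*2.+1; g_ s; h_ s; h_ s; 0; 4 * g_ s; 2 * h_ s; 2 * h_ s]%N; split=> //.
  exact: pequiv_p_doubleS.
rewrite /= !nvalM // nval0 !nval_gt0 // (logn_ndvd2 2 p_odd : logn p 4 = 0)%N (logn_ndvd2 1 p_odd : logn p 2 = 0)%N logn1.
have := @perm_valuations_odd (logn p s.*2.+1) (logn p (h_ s)) (logn p (g_ s)) 0.
by rewrite !add0n; apply; left.
Qed.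

Lemma critical_group_C4_double_odd s : (1 < s)%N -> odd s ->
  let d := torus_factors 1 1 4 12 48 s (e_ s) (f_ s) in
  critical_group (cart_prod (cycle_graph 4) (cycle_graph s.*2)) \simeq
    Zmod (nth 0 d 0) \oplus Zmod (nth 0 d 1) \oplus Zmod (nth 0 d 2)
      \oplus Zmod (nth 0 d 3) \oplus Zmod (nth 0 d 4) \oplus Zmod (nth 0 d 5)
      \oplus Zmod (nth 0 d 6).
Proof.
move=> s_gt1 s_odd; have s_gt0 := ltnW s_gt1.
have e_gt0 : (0 < e_ s)%N by rewrite uN_gt0.
have f_gt0 : (0 < f_ s)%N by rewrite uN_gt0.
have eN : (s.*2 = (s.*2.-1).+1)%N by rewrite prednK ?double_gt0.
rewrite eN; apply: critical_group_torus_factors => //; first by lia.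
move=> p p_prime; rewrite -eN logn_torus_factors //.
have [->|p2] := eqVneq p 2.
  exists [:: 1; 1; 1; 1; 4; 12; 48; 0]%N; split=> //; first exact: pequiv2_double_odd.
  have eo : odd (e_ s) by rewrite uN_odd.
  have fo : odd (f_ s) by rewrite uN_odd.
  by rewrite (logn2_odd s_odd) (logn2_odd eo) (logn2_odd fo); vm_compute.
have p_odd := ndvd2_prime p_prime p2.
exists [:: s; f_ s; e_ s; e_ s; 0; 32 * f_ s; 12 * e_ s; 12 * e_ s]%N; split=> //.
  exact: pequiv_p_double.
have lognX3 e : logn p (2 ^ e * 3) = logn p 3 by rewrite lognM ?expn_gt0 // logn_ndvd2.
rewrite /= !nvalM // nval0 !nval_gt0 // (lognX3 2 : logn p 12 = _) (lognX3 4 : logn p 48 = _).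
rewrite (logn_ndvd2 5 p_odd : logn p 32 = _) (logn_ndvd2 2 p_odd : logn p 4 = _) logn1 !add0n.
apply: perm_valuations_odd; have [->|p3] := eqVneq p 3.
  right; split; first by rewrite lognE (negPf (ndvd3_f_odd s_odd)) !andbF.
  by rewrite logn3_e.
by left; rewrite logn_prime // (negPf p3).
Qed.

Lemma critical_group_C4_double_even k : (0 < k)%N -> let s := k.*2 in
  let d := torus_factors 4 6 6 2 8 s (e_ s) (f_ s) in
  critical_group (cart_prod (cycle_graph 4) (cycle_graph s.*2)) \simeq
    Zmod (nth 0 d 0) \oplus Zmod (nth 0 d 1) \oplus Zmod (nth 0 d 2)
      \oplus Zmod (nth 0 d 3) \oplus Zmod (nth 0 d 4) \oplus Zmod (nth 0 d 5)
      \oplus Zmod (nth 0 d 6).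
Proof.
move=> k_gt0 s; have s_gt0 : (0 < s)%N by rewrite double_gt0.
have e_gt0 : (0 < e_ s)%N by rewrite uN_gt0.
have f_gt0 : (0 < f_ s)%N by rewrite uN_gt0.
have eN : (s.*2 = (s.*2.-1).+1)%N by rewrite prednK ?double_gt0.
rewrite eN; apply: critical_group_torus_factors => //; first by lia.
move=> p p_prime; rewrite -eN logn_torus_factors //.
have [->|p2] := eqVneq p 2.
  exists [seq 2 ^ logn 2 k * x | x <- [:: 2; 2; 8; 24; 24; 24; 96; 0]]%N; split=> //.
    rewrite -map_comp (eq_map (_ : _ =1 fun x : nat => x%:Z *+ 2 ^ logn 2 k)).
      exact: pequiv2_double_even.
    by move=> x; rewrite /= PoszM -[Posz (2 ^ _)]natz mulr_natl.
  have -> : logn 2 s = (logn 2 k).+1.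
    by rewrite /s -muln2 lognM // (@logn_prime 2 2) // addn1.
  rewrite logn2_e_double // logn2_f_double // /= muln0 nval0 !nvalM ?expn_gt0 //.
  rewrite pfactorK //; move: (logn 2 k) => r.
  rewrite (_ : logn 2 2 = 1)%N // (_ : logn 2 8 = 3)%N // (_ : logn 2 24 = 3)%N //.
  rewrite (_ : logn 2 96 = 5)%N // (_ : logn 2 4 = 2)%N // (_ : logn 2 6 = 1)%N //.
  (* With s, e_s, f_s of 2-adic valuation r + 1, r + 2, r + 1, the summands have the valuations of
     2^r times 2, 2, 8, 24, 24, 24, 96, up to order. *)
  rewrite [X in perm_eq _ X](_ : _ = [:: (r + 1).+1; (r + 1).+1; (r + 3).+1; (r + 3).+1;
    (r + 3).+1; (r + 3).+1; (r + 5).+1; 0]%N).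
    by apply/seq.permP => a /=; ring.
  by congr [:: _; _; _; _; _; _; _; _]; lia.
have p_odd := ndvd2_prime p_prime p2.
exists [:: s; f_ s; e_ s; e_ s; 0; 32 * f_ s; 12 * e_ s; 12 * e_ s]%N; split=> //.
  exact: pequiv_p_double.
have lognX3 e : logn p (2 ^ e * 3) = logn p 3 by rewrite lognM ?expn_gt0 // logn_ndvd2.
rewrite /= !nvalM // nval0 !nval_gt0 // (lognX3 2 : logn p 12 = _) (lognX3 1 : logn p 6 = _).
rewrite (logn_ndvd2 5 p_odd : logn p 32 = _) (logn_ndvd2 2 p_odd : logn p 4 = _).
rewrite (logn_ndvd2 1 p_odd : logn p 2 = _) (logn_ndvd2 3 p_odd : logn p 8 = _) !add0n.
apply: perm_valuations_even; have [->|p3] := eqVneq p 3.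
  by right; rewrite logn3_e // leqnn logn3_f_double.
by left; rewrite logn_prime // (negPf p3).
Qed.

Local Close Scope ring_scope.
Local Close Scope quotient_scope.

Theorem theorem5p1 (n : nat) (hn : 3 <= n) :
  (* n = 2s+1 *)
  (forall s : nat, n = 2 * s + 1 ->
     critical_group (cart_prod (cycle_graph 4) (cycle_graph n)) \simeq
       Zmod (gcd3 n (h_ s) (g_ s))
       \oplus Zmod (gcdn (h_ s) (g_ s))
       \oplus Zmod (gcdn n (h_ s) * gcdn (h_ s) (g_ s) %/ gcd3 n (h_ s) (g_ s))
       \oplus Zmod (h_ s)
       \oplus Zmod (h_ s * gcd3 (n * h_ s) (n * g_ s) (h_ s * g_ s)
                   %/ (gcdn n (h_ s) * gcdn (h_ s) (g_ s)))
       \oplus Zmod (h_ s * g_ s %/ gcdn (h_ s) (g_ s))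
       \oplus Zmod (4 * n * h_ s * g_ s
                   %/ gcd3 (n * h_ s) (n * g_ s) (h_ s * g_ s)))
  /\
  (* n = 2s, s odd *)
  (forall s : nat, n = 2 * s -> odd s ->
     critical_group (cart_prod (cycle_graph 4) (cycle_graph n)) \simeq
       Zmod (gcd3 s (e_ s) (f_ s))
       \oplus Zmod (gcdn (e_ s) (f_ s))
       \oplus Zmod (gcdn s (e_ s) * gcdn (e_ s) (f_ s) %/ gcd3 s (e_ s) (f_ s))
       \oplus Zmod (e_ s)
       \oplus Zmod (4 * e_ s * gcd3 (s * e_ s) (s * f_ s) (e_ s * f_ s)
                   %/ (gcdn s (e_ s) * gcdn (e_ s) (f_ s)))
       \oplus Zmod (12 * e_ s * f_ s %/ gcdn (e_ s) (f_ s))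
       \oplus Zmod (48 * s * e_ s * f_ s
                   %/ gcd3 (s * e_ s) (s * f_ s) (e_ s * f_ s)))
  /\
  (* n = 2s, s even *)
  (forall s : nat, n = 2 * s -> ~~ odd s ->
     critical_group (cart_prod (cycle_graph 4) (cycle_graph n)) \simeq
       Zmod (gcd3 s (e_ s) (f_ s))
       \oplus Zmod (gcdn (e_ s) (f_ s))
       \oplus Zmod (4 * gcdn s (e_ s) * gcdn (e_ s) (f_ s)
                   %/ gcd3 s (e_ s) (f_ s))
       \oplus Zmod (6 * e_ s)
       \oplus Zmod (6 * e_ s * gcd3 (s * e_ s) (s * f_ s) (e_ s * f_ s)
                   %/ (gcdn s (e_ s) * gcdn (e_ s) (f_ s)))
       \oplus Zmod (2 * e_ s * f_ s %/ gcdn (e_ s) (f_ s))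
       \oplus Zmod (8 * s * e_ s * f_ s
                   %/ gcd3 (s * e_ s) (s * f_ s) (e_ s * f_ s))).
Proof.
split; [|split] => s en.
- have s_gt0 : 0 < s by lia.
  have -> : n = s.*2.+1 by lia.
  by have := critical_group_C4_odd s_gt0; rewrite /torus_factors /= !mul1n.
- move=> s_odd; have s_gt1 : 1 < s by lia.
  have -> : n = s.*2 by lia.
  by have := critical_group_C4_double_odd s_gt1 s_odd; rewrite /torus_factors /= !mul1n.
move=> s_even; have k_gt0 : 0 < s./2 by lia.
have -> : n = s.*2 by lia.
have := critical_group_C4_double_even k_gt0.
by rewrite even_halfK // /torus_factors /= .
Qed.
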